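(* Let $\Omega\subset\mathbb{R}^n$ be a bounded open set with $0\in\Omega$, and let $E\subset\mathbb{R}^n$ be a variational supersolution in $\Omega$. Assume $0\in\partial E$ and that the unit ball $B_1(-e_n)$ is included in $E$. Then $$\int_{\mathbb{R}^n}\frac{\chi_E(x)-\chi_{\mathcal{C}E}(x)}{|x|^{n+s}}\,dx\le0$$ in the principal value sense, i.e. $\lim_{\delta\to0^+}\int_{\mathbb{R}^n\setminus B_\delta}\frac{\chi_E(x)-\chi_{\mathcal{C}E}(x)}{|x|^{n+s}}\,dx\le0$.
   Context: Fix $n\ge1$ and $0<s<1$; $e_n$ is the last standard basis vector of $\mathbb{R}^n$; $B_r(x)$ is the ball of radius $r$ centered at $x$ and $B_r=B_r(0)$. All sets are Lebesgue measurable; $\mathcal{C}A=\mathbb{R}^n\setminus A$. For $A,B\subset\mathbb{R}^n$, $L(A,B):=\int\int\frac{\chi_A(x)\chi_B(y)}{|x-y|^{n+s}}\,dx\,dy\in[0,\infty]$. A set $E$ is a variational supersolution in $\Omega$ if for every $A\subset\mathcal{C}E\cap\Omega$ one has $L(A,E)-L(A,\mathcal{C}(E\cup A))\le0$, i.e. $L(A,E)\le L(A,\mathcal{C}(E\cup A))$. Convention: sets are modified on a null set so that they contain their measure-theoretic interior (points $x$ with $|B_r(x)\setminus E|=0$ for some $r>0$) and do not meet the measure-theoretic interior of their complement; thus $x\in\partial E$ if and only if $|B_r(x)\cap E|>0$ and $|B_r(x)\cap\mathcal{C}E|>0$ for all $r>0$. *)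

(* Defs.v *)
From HB Require Import structures.
From mathcomp Require Import all_boot all_order all_algebra.
From mathcomp Require Import all_classical all_reals all_analysis.

Set Implicit Arguments.
Unset Strict Implicit.
Unset Printing Implicit Defensive.

Import Order.TTheory GRing.Theory Num.Theory.
Import numFieldNormedType.Exports.

Local Open Scope classical_set_scope.
Local Open Scope ring_scope.

(** The Borel sets of R^n = 'rV[R]_n: the sigma-algebra generated by the
    coordinate projections. *)
Definition rV_display : measure_display.
Proof. exact: default_measure_display. Qed.

Section rV_measurable.
Context {R : realType} {n : nat}.

Definition rV_coor (i : 'I_n) (x : 'rV[R]_n) : measurableTypeR R := x ord0 i.

Let rV_set0 : g_sigma_preimage rV_coor set0.
Proof. exact: sigma_algebra0. Qed.

Let rV_setC A : g_sigma_preimage rV_coor A -> g_sigma_preimage rV_coor (~` A).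
Proof. exact: sigma_algebraC. Qed.

Let rV_bigcup (F : _^nat) : (forall i, g_sigma_preimage rV_coor (F i)) ->
  g_sigma_preimage rV_coor (\bigcup_i (F i)).
Proof. exact: sigma_algebra_bigcup. Qed.

HB.instance Definition _ := @isMeasurable.Build rV_display
  'rV[R]_n (g_sigma_preimage rV_coor) rV_set0 rV_setC rV_bigcup.

Lemma measurable_rV_coor (i : 'I_n) : measurable_fun [set: 'rV[R]_n] (rV_coor i).
Proof.
move=> _ Y mY; rewrite setTI; apply: sub_sigma_algebra => /=.
rewrite -bigcup_seq/=; exists i => /=; first by rewrite mem_index_enum.
by exists Y => //; rewrite setTI.
Qed.

Lemma measurable_fun_rV d (T : measurableType d) (f : T -> 'rV[R]_n) :
  (forall i, measurable_fun [set: T] (rV_coor i \o f)) ->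
  measurable_fun [set: T] f.
Proof.
move=> mf; have sub : g_sigma_preimage (fun i => rV_coor i \o f) `<=` measurable.
  apply: smallest_sub; first exact: sigma_algebra_measurable.
  move=> A; rewrite -bigcup_seq => -[i _ [B mB <-]].
  exact: mf.
rewrite g_sigma_preimage_comp in sub.
by move=> _ A mA; apply: sub; exists A.
Qed.

Lemma measurable_rV_box (A : 'I_n -> set (measurableTypeR R)) :
  (forall i, measurable (A i)) ->
  measurable [set x : 'rV[R]_n | forall i, A i (x ord0 i)].
Proof.
move=> mA; rewrite [X in measurable X](_ : _ = \bigcap_(i in [set: 'I_n])
    (rV_coor i @^-1` A i)).
  apply: fin_bigcap_measurable => // i _.
  by rewrite -[X in measurable X]setTI; exact: measurable_rV_coor.
by apply/seteqP; split => x /= xA i => [_|]; exact: xA.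
Qed.

End rV_measurable.

Section rV_cons.
Context {R : realType} {n : nat}.

Definition rV_cons (p : measurableTypeR R * 'rV[R]_n) : 'rV[R]_n.+1 :=
  \row_i if unlift ord0 i is Some j then p.2 ord0 j else p.1.

Lemma measurable_rV_cons : measurable_fun [set: _] rV_cons.
Proof.
apply: measurable_fun_rV => i.
case: (unliftP ord0 i) => [j|] ->.
  rewrite (_ : _ \o _ = rV_coor j \o snd); last first.
    by apply/funext => p /=; rewrite /rV_coor mxE liftK.
  apply: measurableT_comp; [exact: measurable_rV_coor|exact: measurable_snd].
rewrite (_ : _ \o _ = fst); first exact: measurable_fst.
by apply/funext => p /=; rewrite /rV_coor mxE unlift_none.
Qed.

Lemma rV_cons_surj (x : 'rV[R]_n.+1) :
  x = rV_cons (x ord0 ord0, \row_j x ord0 (lift ord0 j)).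
Proof.
apply/rowP => i; rewrite mxE.
by case: (unliftP ord0 i) => [j|] -> /=; rewrite ?mxE.
Qed.

Lemma rV_cons_inj : injective rV_cons.
Proof.
move=> [a x] [b y] /rowP xy; congr pair.
  by have := xy ord0; rewrite !mxE unlift_none.
by apply/rowP => j; have := xy (lift ord0 j); rewrite !mxE liftK.
Qed.

Lemma measurable_rV_uncons : measurable_fun [set: 'rV[R]_n.+1]
  (fun x => (x ord0 ord0 : measurableTypeR R, \row_j x ord0 (lift ord0 j))).
Proof.
apply: measurable_fun_pair; first exact: (measurable_rV_coor ord0).
apply: measurable_fun_rV => i.
rewrite (_ : _ \o _ = rV_coor (lift ord0 i)); first exact: measurable_rV_coor.
by apply/funext => x /=; rewrite /rV_coor mxE.
Qed.

Variable mu : {sigma_finite_measure set 'rV[R]_n -> \bar R}.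

(** The product measure on R * R^n, transported to R^(n+1). *)
Definition lebesgue_rV_step : set 'rV[R]_n.+1 -> \bar R :=
  pushforward (@lebesgue_measure R \x mu)%E rV_cons.


Let step_ge0 A : (0 <= lebesgue_rV_step A)%E.
Proof. by rewrite /lebesgue_rV_step /pushforward measure_ge0. Qed.

Let step0 : lebesgue_rV_step set0 = 0%E.
Proof. by rewrite /lebesgue_rV_step /pushforward preimage_set0 measure0. Qed.

Let step_sigma_additive : semi_sigma_additive lebesgue_rV_step.
Proof.
move=> F mF tF mUF; rewrite /lebesgue_rV_step /pushforward preimage_bigcup.
apply: measure_semi_sigma_additive.
- by move=> k; rewrite -[X in measurable X]setTI; exact: measurable_rV_cons.
- apply/trivIsetP => /= i j _ _ ij; rewrite -preimage_setI.
  by move/trivIsetP : tF => /(_ _ _ _ _ ij) ->//; rewrite preimage_set0.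
- by rewrite -preimage_bigcup -[X in measurable X]setTI;
    exact: measurable_rV_cons.
Qed.

HB.instance Definition _ := isMeasure.Build _ _ _ lebesgue_rV_step
  step0 step_ge0 step_sigma_additive.

Let step_sigma_finite : sigma_finite setT lebesgue_rV_step.
Proof.
have /sigma_finiteP[F [TF ndF Foo]] := sigma_finiteT (@lebesgue_measure R).
have /sigma_finiteP[G [TG ndG Goo]] := sigma_finiteT mu.
pose g (x : 'rV[R]_n.+1) : measurableTypeR R * 'rV[R]_n :=
  (x ord0 ord0, \row_j x ord0 (lift ord0 j)).
have gK : cancel rV_cons g.
  by move=> p; apply: rV_cons_inj; rewrite /g -rV_cons_surj.
exists (fun k => g @^-1` (F k `*` G k)).
  rewrite -preimage_bigcup (_ : \bigcup_k _ = setT) ?preimage_setT//.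
  apply/seteqP; split => // -[x y] _.
  have [i _ Fx] : (\bigcup_k F k) x by rewrite -TF.
  have [j _ Gy] : (\bigcup_k G k) y by rewrite -TG.
  exists (maxn i j) => //; split => /=.
  - by move: x Fx; exact/subsetPset/ndF/leq_maxl.
  - by move: y Gy; exact/subsetPset/ndG/leq_maxr.
move=> k; have [mF Fk] := Foo k; have [mG Gk] := Goo k; split.
  rewrite -[X in measurable X]setTI.
  by apply: measurable_rV_uncons => //; exact: measurableX.
rewrite /lebesgue_rV_step /pushforward -comp_preimage.
rewrite (_ : g \o rV_cons = id); last by apply/funext => p; exact: gK.
rewrite preimage_id product_measure1E//.
by rewrite lte_mul_pinfty// ge0_fin_numE.
Qed.

HB.instance Definition _ := Measure_isSigmaFinite.Build _ _ _ lebesgue_rV_step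
  step_sigma_finite.

End rV_cons.

Section lebesgue_rV.
Context {R : realType}.

Fixpoint lebesgue_rV_borel (n : nat) :
    {sigma_finite_measure set 'rV[R]_n -> \bar R} :=
  if n is m.+1 then lebesgue_rV_step (lebesgue_rV_borel m)
  else dirac (0 : 'rV[R]_0).

Lemma lebesgue_rV_borel_box n (A : 'I_n -> set (measurableTypeR R)) :
  (forall i, measurable (A i)) ->
  lebesgue_rV_borel n [set x | forall i, A i (x ord0 i)] =
  (\prod_(i < n) lebesgue_measure (A i))%E.
Proof.
elim: n A => [|n IHn] A mA.
  by rewrite big_ord0 /= diracE mem_set// => -[].
rewrite big_ord_recl -IHn// -product_measure1E//; last first.
  by apply: (measurable_rV_box (A := fun i => A (lift ord0 i))).
rewrite /= /lebesgue_rV_step /pushforward; congr (_ _).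
apply/seteqP; split => -[y x] /=.
  move=> yxA; split => [|j].
    by have := yxA ord0; rewrite mxE unlift_none.
  by have := yxA (lift ord0 j); rewrite mxE liftK.
move=> [yA xA] i; rewrite mxE.
by case: (unliftP ord0 i) => [j|] ->.
Qed.

End lebesgue_rV.

(** Lebesgue measure on R^n is the completion of [lebesgue_rV_borel n]; the
    measurable sets of [lebesgue_rV_type R n], a copy of 'rV[R]_n, are the
    Lebesgue measurable sets. *)
Definition lebesgue_rV_type (R : realType) (n : nat) : Type :=
  caratheodory_type ((@lebesgue_rV_borel R n)^*)%mu.

HB.instance Definition _ R n := Measurable.on (lebesgue_rV_type R n).

Definition lebesgue_rV (R : realType) (n : nat) :
    set (lebesgue_rV_type R n) -> \bar R :=
  @completed_measure_extension _ _ _ (lebesgue_rV_borel n).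
Arguments lebesgue_rV : clear implicits.

HB.instance Definition _ R n := Measure.on (lebesgue_rV R n).

Lemma lebesgue_rV_sigma_finite R n : sigma_finite setT (lebesgue_rV R n).
Proof.
exact: (@completed_measure_extension_sigma_finite _ _ _ (lebesgue_rV_borel n))
  (sigma_finiteT _).
Qed.

HB.instance Definition _ R n := Measure_isSigmaFinite.Build _ _ _
  (lebesgue_rV R n) (@lebesgue_rV_sigma_finite R n).

Lemma lebesgue_rV_box (R : realType) n (A : 'I_n -> set (measurableTypeR R)) :
  (forall i, measurable (A i)) ->
  lebesgue_rV R n [set x | forall i, A i (x ord0 i)] =
  (\prod_(i < n) lebesgue_measure (A i))%E.
Proof.
move=> mA; rewrite -lebesgue_rV_borel_box//.
rewrite /lebesgue_rV /completed_measure_extension measurable_mu_extE//.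
exact: measurable_rV_box.
Qed.

Definition lebesgue_measurable (R : realType) (n : nat) (A : set 'rV[R]_n) :
  Prop := measurable (A : set (lebesgue_rV_type R n)).

Section nonlocal_minimal.
Context {R : realType} {n : nat}.
Implicit Types (A B E Omega : set 'rV[R]_n) (x y : 'rV[R]_n).

(** The norm [`|x|] of the library on 'rV[R]_n is the sup norm. *)
Definition enorm x : R := Num.sqrt (\sum_(i < n) (x ord0 i) ^+ 2).

Definition eball x (r : R) : set 'rV[R]_n := [set y | enorm (y - x) < r].

(** On the diagonal, which is a null set, the kernel is 0 because 0^-1 = 0. *)
Definition nonlocal_L (s : R) A B : \bar R :=
  (\int[lebesgue_rV R n]_y \int[lebesgue_rV R n]_x
     ((\1_A x * \1_B y) / enorm (x - y) `^ (n%:R + s))%:E)%E.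

Definition variational_supersolution (s : R) Omega E : Prop :=
  forall A, lebesgue_measurable A -> A `<=` ~` E `&` Omega ->
    (nonlocal_L s A E <= nonlocal_L s A (~` (E `|` A)))%E.

Definition measure_interior E : set 'rV[R]_n :=
  [set x | exists2 r : R, 0 < r & lebesgue_rV R n (eball x r `\` E) = 0%E].

(** Among the sets equal to E up to a null set, the representatives for which
    the topological boundary is the measure-theoretic one. *)
Definition measure_normalized E : Prop :=
  measure_interior E `<=` E /\ E `&` measure_interior (~` E) = set0.

Definition boundary E : set 'rV[R]_n := closure E `\` interior E.

(** The integral over R^n minus a ball whose limit is the principal value. *)
Definition truncated_curvature (s : R) E (delta : R) : \bar R :=
  (\int[lebesgue_rV R n]_(x in ~` eball 0 delta)
     ((\1_E x - \1_(~` E) x) / enorm x `^ (n%:R + s))%:E)%E.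

End nonlocal_minimal.

(* Main.v *)
(** The curvature of [E] at 0, truncated at radius [r], is called T(r) here.
    Put phi(x) = |x + e_n/2| and A = {phi < 1/2 + eps} \ E and, for x in A, let
    F_x = E u {phi < phi(x)}.  Integrating the truncated curvature of F_x at x
    over x in A gives L(A, E) - L(A, C(E u A)): the part of F_x inside A
    contributes an antisymmetric kernel, which cancels.  Since F_x contains a
    ball of radius 1/2 touching x, its curvature coming from B_r(x) is at least
    - C r^(1-s), the integral of the kernel over a cusp; the contribution of the
    complement of B_r(x) is at least T(r) up to an error that vanishes with eps,
    because F_x contains E and x is close to 0.  If T(r) > C r^(1-s), then
    L(A, E) exceeds L(A, C(E u A)) by a multiple of |A| > 0, and the latter is
    finite because balls have finite fractional perimeter: this contradicts the
    supersolution property.  So T(r) <= C r^(1-s) for all r.  The same cusp bound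
    at 0 gives T(r) - C r^(1-s) <= T(d) for d < r, hence T(d) converges, as d
    tends to 0, to sup_r (T(r) - C r^(1-s)) <= 0. *)

Require Import Defs.
From mathcomp Require Import all_boot all_order all_algebra.
From mathcomp Require Import all_classical all_reals all_analysis.
From mathcomp Require Import measurable_realfun ring lra.

Set Implicit Arguments.
Unset Strict Implicit.
Unset Printing Implicit Defensive.

Import Order.TTheory GRing.Theory Num.Theory.
Import numFieldNormedType.Exports.

Local Open Scope classical_set_scope.
Local Open Scope ring_scope.

(** * Uniqueness and invariance of Lebesgue measure *)

(** The ball of radius 1/2 replaces the given unit ball because the two touch only at 0 and separate
    quadratically there. A slightly larger ball {phi < 1/2 + eps} therefore leaves the unit ball
    only near 0, so A shrinks to 0 with eps and eventually lies in Omega; enlarging the unit ball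
    itself would give a set that need not concentrate at 0. The kernel is not integrable across the
    diagonal, so the cancellation inside A could read oo - oo. It is carried out on pairs at
    distance at least d, where the cancelled mass is finite, with a gain independent of d; monotone
    convergence then lets d tend to 0. The exponent 1 - s comes from the cusp between two tangent
    balls: inside B_r its volume is smaller than that of B_r by a factor of order r, and s < 1 makes
    the kernel integrable there. *)

Section uniqueness.
Context {R : realType}.

(** Measurable boxes are stable under intersection, generate the sigma-algebra and contain an
    exhaustion by cubes of finite measure. Invariance and reordering of coordinates thus need to be
    checked on boxes only. *)
Lemma lebesgue_rV_borel_unique n (m : {measure set 'rV[R]_n -> \bar R}) :
  (forall A : 'I_n -> set (measurableTypeR R), (forall i, measurable (A i)) ->
     m [set x : 'rV[R]_n | forall i, A i (x ord0 i)] =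
     (\prod_(i < n) lebesgue_measure (A i))%E) ->
  forall X, measurable X -> lebesgue_rV_borel n X = m X.
Proof.
move=> mbox.
pose G : set (set 'rV[R]_n) := [set B | exists2 A : 'I_n -> set (measurableTypeR R),
  (forall i, measurable (A i)) & B = [set x : 'rV[R]_n | forall i, A i (x ord0 i)]].
pose g k := [set x : 'rV[R]_n | forall i, `]-(k%:R : R), k%:R[%classic (x ord0 i)].
have mg k : forall i : 'I_n,
    measurable (`]-(k%:R : R), k%:R[%classic : set (measurableTypeR R)).
  by move=> i; exact: measurable_itv.
apply: (measure_unique G g).
- apply/seteqP; split.
    apply: smallest_sub; first exact: smallest_sigma_algebra.
    move=> B; rewrite -bigcup_seq => -[i _ [C mC <-]].
    apply: sub_sigma_algebra.
    exists (fun j => if j == i then C else setT).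
      by move=> j; case: ifP.
    rewrite setTI; apply/seteqP; split => x /=.
      by move=> Cx j; case: eqP => [->|].
    by move/(_ i); rewrite eqxx.
  apply: smallest_sub; first exact: sigma_algebra_measurable.
  by move=> _ [A mA ->]; exact: measurable_rV_box.
- move=> _ _ [A mA ->] [B mB ->]; exists (fun i => A i `&` B i).
    by move=> i; exact: measurableI.
  apply/seteqP; split => x /=.
    by move=> [xA xB] i; split; [exact: xA|exact: xB].
  by move=> xAB; split => i; have [] := xAB i.
- by move=> k; exists (fun=> `]-(k%:R : R), k%:R[%classic).
- apply/seteqP; split=> // x _.
  have [k xk] : exists k, \sum_i `|x ord0 i| < k%:R.
    exists (Num.trunc (\sum_i `|x ord0 i|)).+1.
    by rewrite truncnS_gt.
  exists k => // i /=; rewrite in_itv/= -ltr_norml.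
  apply: le_lt_trans xk; rewrite (bigD1 i)//= lerDl.
  by apply: sumr_ge0.
- by move=> _ [A mA ->]; rewrite mbox//; exact: lebesgue_rV_borel_box.
- move=> k; pose I : set (measurableTypeR R) := `]-(k%:R : R), k%:R[%classic.
  have E : lebesgue_rV_borel n (g k) = (\prod_(i < n) lebesgue_measure I)%E.
    exact: lebesgue_rV_borel_box (mg k).
  suff : (\prod_(i < n) lebesgue_measure I < +oo)%E by rewrite -E.
  have ioo : (0 <= lebesgue_measure I < +oo)%E.
    rewrite measure_ge0 lebesgue_measure_itv/=.
    by case: ifP => _; rewrite ?ltry// -EFinB ltry.
  elim: n {m mbox G g mg E} => [|n IH]; first by rewrite big_ord0 ltry.
  rewrite big_ord_recl lte_mul_pinfty//.
  by case/andP: ioo => ? ?; rewrite ge0_fin_numE.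
Qed.
End uniqueness.

(** Uniqueness statements expect a bundled measure; the existential provides one and keeps only its
    values, which is all that a comparison on generators uses. *)
Lemma mscale_pushforward_ex d1 d2 (T1 : measurableType d1) (T2 : measurableType d2)
    (R : realType) (m : {measure set T1 -> \bar R}) (f : T1 -> T2) (c : R) :
  0 <= c -> measurable_fun setT f ->
  exists m' : {measure set T2 -> \bar R},
    forall A, m' A = (c%:E * m (f @^-1` A))%E.
Proof.
by move=> c0 mf; unshelve eexists (mscale (NngNum c0) (pushforward m f)).
Qed.

Section affine.
Context {R : realType}.

Lemma lebesgue_measure_affine (a b : R) (A : set (measurableTypeR R)) :
  a != 0 -> measurable A ->
  lebesgue_measure A =
  (`|a|%:E * lebesgue_measure ((fun x => (a * x + b)%R : measurableTypeR R) @^-1` A))%E.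
Proof.
move=> a0 mA; pose f := (fun x : measurableTypeR R => (a * x + b)%R : measurableTypeR R).
have mf : measurable_fun setT f.
  by apply: measurable_funD => //; exact: measurable_funM.
have na : (0 <= `|a|) by [].
have [m mE] := mscale_pushforward_ex (lebesgue_measure) na mf.
rewrite (@lebesgue_measure_unique R m)//.
move=> X /ocitvP[->|[[u v] /= uv ->]].
  rewrite (measure0 m); exact: (measure0 lebesgue_measure).
rewrite mE /=.
have [a_gt0|a_lt0|/eqP] := ltgtP 0 a; last by rewrite eq_sym (negbTE a0).
  rewrite [f @^-1` _](_ : _ = `](u - b) / a, (v - b) / a]%classic); last first.
    apply/seteqP; split => x /=; rewrite !in_itv/= ltr_pdivrMr//;
      by rewrite ler_pdivlMr// mulrC ltrBlDr lerBrDr.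
  rewrite !lebesgue_measure_itv/= !lte_fin ltr_pM2r ?invr_gt0// ltrD2r uv.
  by rewrite -!EFinD -EFinM; congr EFin; rewrite gtr0_norm//; field.
(* For [a < 0] the map reverses the order, so the closed end of the interval changes sides; the
   length is unaffected. *)
rewrite [f @^-1` _](_ : _ = `[(v - b) / a, (u - b) / a[%classic); last first.
  apply/seteqP; split => x /=; rewrite !in_itv/= ler_ndivrMr//;
    by rewrite ltr_ndivlMr// mulrC andbC ltrBlDr lerBrDr.
rewrite !lebesgue_measure_itv/= !lte_fin ltr_nM2r ?invr_lt0// ltrD2r uv.
by rewrite -!EFinD -EFinM; congr EFin; rewrite ltr0_norm//; field.
Qed.

Lemma measurable_rV_affine n (a : R) (b : 'rV[R]_n) :
  measurable_fun setT (fun x : 'rV[R]_n => a *: x + b).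
Proof.
apply: measurable_fun_rV => i.
rewrite (_ : _ \o _ = (fun x => a * rV_coor i x + b ord0 i)); last first.
  by apply/funext => x; rewrite /rV_coor /= !mxE.
apply: measurable_funD => //; apply: measurable_funM => //.
exact: measurable_rV_coor.
Qed.

Lemma lebesgue_rV_borel_affine n (a : R) (b : 'rV[R]_n) (A : set 'rV[R]_n) :
  a != 0 -> measurable A ->
  lebesgue_rV_borel n A =
  ((`|a| ^+ n)%:E * lebesgue_rV_borel n ((fun x => (a *: x + b)%R) @^-1` A))%E.
Proof.
move=> a0 mA.
have na : (0 <= `|a| ^+ n) by apply: exprn_ge0.
have [m mE] := mscale_pushforward_ex (lebesgue_rV_borel n) na
  (@measurable_rV_affine n a b).
rewrite (@lebesgue_rV_borel_unique R n m)//.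
move=> B mB; rewrite mE /=.
transitivity (\prod_(i < n) (`|a|%:E *
  lebesgue_measure ((fun x => (a * x + b ord0 i)%R : measurableTypeR R) @^-1` B i)))%E; last first.
  by apply: eq_bigr => i _; rewrite -lebesgue_measure_affine.
rewrite big_split/= prodEFin prodr_const card_ord; congr (_ * _)%E.
rewrite -lebesgue_rV_borel_box; last first.
  move=> i; rewrite -[X in measurable X]setTI.
  have : measurable_fun setT
      (fun x : measurableTypeR R => (a * x + b ord0 i)%R : measurableTypeR R).
    by apply: measurable_funD => //; exact: measurable_funM.
  by apply.
congr (lebesgue_rV_borel n _); apply/seteqP; split => x /= Bx i;
  by have := Bx i; rewrite !mxE.
Qed.

(** Preimages of a Borel cover form a Borel cover of the same total measure. Arbitrary [X] is
    allowed because Lebesgue measurable sets are the Caratheodory sets of the outer measure, whose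
    criterion tests all sets. *)
Lemma lebesgue_rV_outer_le n (f : 'rV[R]_n -> 'rV[R]_n) :
  measurable_fun setT f ->
  (forall A, measurable A -> lebesgue_rV_borel n (f @^-1` A) = lebesgue_rV_borel n A) ->
  forall X, (mu_ext (lebesgue_rV_borel n) (f @^-1` X) <=
             mu_ext (lebesgue_rV_borel n) X)%E.
Proof.
move=> mf fE X; rewrite {2}/mu_ext.
apply: le_ereal_inf_tmp => _ [F [mF XF] <-].
apply: ereal_inf_lbound; exists (fun k => f @^-1` F k).
  split; last by rewrite -preimage_bigcup; exact: preimage_subset.
  by move=> k; rewrite -[X in measurable X]setTI; exact: mf.
by apply: eq_eseriesr => k _; exact: fE.
Qed.

Section preserving.
Context {n : nat} {f g : 'rV[R]_n -> 'rV[R]_n}.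
Hypothesis fK : cancel f g.
Hypothesis gK : cancel g f.
Hypothesis mf : measurable_fun setT f.
Hypothesis mg : measurable_fun setT g.
Hypothesis fE : forall A, measurable A ->
  lebesgue_rV_borel n (f @^-1` A) = lebesgue_rV_borel n A.

Let gE A : measurable A -> lebesgue_rV_borel n (g @^-1` A) = lebesgue_rV_borel n A.
Proof.
move=> mA; rewrite -fE; last by rewrite -[X in measurable X]setTI; exact: mg.
by congr (lebesgue_rV_borel n _); apply/seteqP; split => x /=; rewrite fK.
Qed.

Let fextE X : mu_ext (lebesgue_rV_borel n) (f @^-1` X) = mu_ext (lebesgue_rV_borel n) X.
Proof.
apply/eqP; rewrite eq_le lebesgue_rV_outer_le//=.
rewrite [X in (mu_ext _ X <= _)%E](_ : X = g @^-1` (f @^-1` X)); last first.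
  by apply/seteqP; split => x /=; rewrite gK.
exact: lebesgue_rV_outer_le.
Qed.

(** Since [f] preserves the outer measure, the Caratheodory criterion for the preimage of [A]
    against [X] is the criterion for [A] against the preimage of [X] under [g]. *)
Lemma measurable_lebesgue_preserving :
  measurable_fun [set: lebesgue_rV_type R n]
    (f : lebesgue_rV_type R n -> lebesgue_rV_type R n).
Proof.
move=> _ A; rewrite setTI => mA.
suff : caratheodory_measurable (mu_ext (lebesgue_rV_borel n)) (f @^-1` A) by [].
have {}mA : caratheodory_measurable (mu_ext (lebesgue_rV_borel n)) A by [].
move=> X.
have -> : mu_ext (lebesgue_rV_borel n) X =
    mu_ext (lebesgue_rV_borel n) (g @^-1` X).
  by rewrite -[RHS]fextE; congr (mu_ext _ _); apply/seteqP; split => x /=; rewrite fK.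
rewrite mA; congr (_ + _)%E; rewrite -[LHS]fextE; congr (mu_ext _ _);
  by apply/seteqP; split => x /=; rewrite fK.
Qed.

Lemma lebesgue_rV_preserving A : lebesgue_rV R n (f @^-1` A) = lebesgue_rV R n A.
Proof. exact: fextE. Qed.

Lemma ge0_integral_preserving (h : lebesgue_rV_type R n -> \bar R) :
  measurable_fun setT h -> (forall x, (0 <= h x)%E) ->
  (\int[lebesgue_rV R n]_x h (f x) = \int[lebesgue_rV R n]_x h x)%E.
Proof.
move=> mh h0; pose f' : lebesgue_rV_type R n -> lebesgue_rV_type R n := f.
have mf' : measurable_fun setT f' := measurable_lebesgue_preserving.
have := ge0_integral_pushforward mf' (lebesgue_rV R n) measurableT mh (fun y _ => h0 y).
rewrite preimage_setT => <-.
apply: eq_measure_integral => A mA _; exact: lebesgue_rV_preserving.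
Qed.
End preserving.

End affine.

(** * The Euclidean norm *)

Section enorm.
Context {R : realType} {n : nat}.
Implicit Types x y z : 'rV[R]_n.

Definition dot x y : R := \sum_(i < n) x ord0 i * y ord0 i.

Lemma dotC x y : dot x y = dot y x.
Proof. by apply: eq_bigr => i _; rewrite mulrC. Qed.

Lemma dotDl x y z : dot (x + y) z = dot x z + dot y z.
Proof. by rewrite -big_split; apply: eq_bigr => i _; rewrite mxE mulrDl. Qed.

Lemma dotZl a x y : dot (a *: x) y = a * dot x y.
Proof. by rewrite mulr_sumr; apply: eq_bigr => i _; rewrite mxE mulrA. Qed.

Lemma dotDr x y z : dot x (y + z) = dot x y + dot x z.
Proof. by rewrite dotC dotDl !(dotC x). Qed.

Lemma dotZr a x y : dot x (a *: y) = a * dot x y.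
Proof. by rewrite dotC dotZl dotC. Qed.

Lemma dotNl x y : dot (- x) y = - dot x y.
Proof. by rewrite -scaleN1r dotZl mulN1r. Qed.

Lemma dotNr x y : dot x (- y) = - dot x y.
Proof. by rewrite dotC dotNl dotC. Qed.

Lemma dotxx_ge0 x : 0 <= dot x x.
Proof. by apply: sumr_ge0 => i _; rewrite -expr2 sqr_ge0. Qed.

Lemma enormE x : enorm x = Num.sqrt (dot x x).
Proof. by congr Num.sqrt; apply: eq_bigr => i _; rewrite expr2. Qed.

Lemma sqr_enorm x : enorm x ^+ 2 = dot x x.
Proof. by rewrite enormE sqr_sqrtr// dotxx_ge0. Qed.

Lemma enorm_ge0 x : 0 <= enorm x.
Proof. exact: sqrtr_ge0. Qed.

Lemma enorm_ler x (r : R) : 0 <= r -> (enorm x <= r) = (dot x x <= r ^+ 2).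
Proof. by move=> r0; rewrite -sqr_enorm ler_sqr// nnegrE enorm_ge0. Qed.

Lemma enorm_ltr x (r : R) : 0 <= r -> (enorm x < r) = (dot x x < r ^+ 2).
Proof. by move=> r0; rewrite -sqr_enorm ltr_sqr// nnegrE enorm_ge0. Qed.

Lemma ler_coor_enorm x i : `|x ord0 i| <= enorm x.
Proof.
rewrite -(@ler_sqr _ `|_|) ?nnegrE ?enorm_ge0// sqr_enorm.
rewrite /dot (bigD1 i)//= real_normK ?num_real// expr2 lerDl.
by apply: sumr_ge0 => j _; rewrite -expr2 sqr_ge0.
Qed.

Lemma enorm0P x : reflect (x = 0) (enorm x == 0).
Proof.
apply: (iffP eqP) => [x0|->]; last first.
  by rewrite enormE /dot big1 ?sqrtr0// => i _; rewrite mxE mul0r.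
apply/rowP => i; apply/eqP; rewrite mxE -normr_le0.
by rewrite (le_trans (ler_coor_enorm x i))// x0.
Qed.

Lemma enorm_gt0 x : (0 < enorm x) = (x != 0).
Proof. by rewrite lt_def enorm_ge0 andbT; congr negb; apply/enorm0P/eqP. Qed.

Lemma enormZ a x : enorm (a *: x) = `|a| * enorm x.
Proof. by rewrite !enormE dotZl dotZr mulrA -expr2 sqrtrM ?sqr_ge0// sqrtr_sqr. Qed.

Lemma enormN x : enorm (- x) = enorm x.
Proof. by rewrite -scaleN1r enormZ normrN1 mul1r. Qed.

Lemma enormB x y : enorm (x - y) = enorm (y - x).
Proof. by rewrite -enormN opprB. Qed.

Lemma dot_le_enorm x y : dot x y <= enorm x * enorm y.
Proof.
have [->|x0] := eqVneq x 0.
  by rewrite /dot big1 ?mulr_ge0 ?enorm_ge0// => i _; rewrite mxE mul0r.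
have [->|y0] := eqVneq y 0.
  by rewrite /dot big1 ?mulr_ge0 ?enorm_ge0// => i _; rewrite mxE mulr0.
(* The two vectors have the same length, so the square of their difference is 2|x||y|(|x||y| -
   x.y). *)
have := dotxx_ge0 (enorm y *: x - enorm x *: y).
rewrite !(dotDl, dotDr, dotNl, dotNr, dotZl, dotZr) -!sqr_enorm (dotC y x) => h.
have xy : 0 < enorm x * enorm y by rewrite mulr_gt0// enorm_gt0.
rewrite -(ler_pM2l xy); nra.
Qed.

Lemma ler_enormD x y : enorm (x + y) <= enorm x + enorm y.
Proof.
rewrite enorm_ler ?addr_ge0 ?enorm_ge0// !(dotDl, dotDr) (dotC y x) -!sqr_enorm.
by have := dot_le_enorm x y; nra.
Qed.

Lemma ler_enormB x y : enorm x - enorm y <= enorm (x - y).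
Proof. by rewrite lerBlDr; apply: le_trans (ler_enormD _ _); rewrite subrK. Qed.

Lemma enorm_le_sum x : enorm x <= \sum_i `|x ord0 i|.
Proof.
rewrite -(@ler_sqr _ (enorm x)) ?nnegrE ?enorm_ge0 ?sumr_ge0// sqr_enorm expr2 mulr_suml.
apply: ler_sum => i _; apply: (@le_trans _ _ (`|x ord0 i| * `|x ord0 i|)).
  by rewrite -normrM ler_norm.
by rewrite ler_wpM2l// (bigD1 i)//= lerDl sumr_ge0.
Qed.

Lemma measurable_enorm : measurable_fun [set: 'rV[R]_n] enorm.
Proof.
rewrite (_ : enorm = fun x => (\sum_(i < n) (rV_coor i x) ^+ 2) `^ 2^-1); last first.
  by apply/funext => x; rewrite /enorm -powR12_sqrt// sumr_ge0// => i _; rewrite sqr_ge0.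
apply: (@measurableT_comp _ _ _ _ _ _ (@powR R ^~ 2^-1)); first exact: measurable_powR.
apply: measurable_sum => i; apply: measurable_funX.
exact: measurable_rV_coor.
Qed.

End enorm.

(** * Balls and slabs *)

Section lebesgue.
Context {R : realType} {n : nat}.
Local Notation X := (lebesgue_rV_type R n).
Local Notation mu := (lebesgue_rV R n).

Lemma borel_lebesgue_measurable (A : set 'rV[R]_n) :
  measurable A -> lebesgue_measurable A.
Proof. by move=> mA; apply: sub_caratheodory; exact: sub_sigma_algebra. Qed.

Lemma lebesgue_rV_borelE (A : set 'rV[R]_n) : measurable A ->
  mu A = lebesgue_rV_borel n A.
Proof.
by move=> mA; rewrite /lebesgue_rV /completed_measure_extension measurable_mu_extE.
Qed.

Lemma measurable_fun_lebesgue d (T : measurableType d) (f : 'rV[R]_n -> T) :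
  measurable_fun setT f -> measurable_fun [set: X] (f : X -> T).
Proof.
move=> mf _ A mA; rewrite setTI; apply: borel_lebesgue_measurable.
by rewrite -[X in measurable X]setTI; exact: mf.
Qed.

Lemma measurable_enormX : measurable_fun [set: X] (enorm : X -> R).
Proof. by apply: measurable_fun_lebesgue; apply: measurable_enorm. Qed.

Section isometry.
Variables (a : R) (b : 'rV[R]_n).
Hypothesis a1 : `|a| = 1.
Let f x : 'rV[R]_n := a *: x + b.
Let g x : 'rV[R]_n := a *: x + - (a *: b).

Let aa : a * a = 1.
Proof. by rewrite -expr2 -real_normK ?num_real// a1 expr1n. Qed.

Let a0 : a != 0.
Proof. by rewrite -normr_gt0 a1. Qed.

Let fK : cancel f g.
Proof. by move=> x; rewrite /f /g scalerDr scalerA aa scale1r addrK. Qed.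

Let gK : cancel g f.
Proof. by move=> x; rewrite /f /g scalerDr scalerN !scalerA aa !scale1r subrK. Qed.

Let fE A : measurable A -> lebesgue_rV_borel n (f @^-1` A) = lebesgue_rV_borel n A.
Proof.
by move=> mA; rewrite (lebesgue_rV_borel_affine b a0 mA) a1 expr1n mul1e.
Qed.

Lemma measurable_fun_isometry : measurable_fun [set: X] (f : X -> X).
Proof.
apply: (measurable_lebesgue_preserving fK gK _ _ fE); exact: measurable_rV_affine.
Qed.

(** One affine form covers both changes of variables used later: translations ([a = 1]) and the
    reflection through the origin ([a = -1]). *)
Lemma ge0_integral_isometry (h : X -> \bar R) :
  measurable_fun setT h -> (forall x, (0 <= h x)%E) ->
  (\int[mu]_x h (a *: x + b)%R = \int[mu]_x h x)%E.
Proof.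
by apply: (ge0_integral_preserving fK gK _ _ fE); exact: measurable_rV_affine.
Qed.

End isometry.

Lemma measurable_eball (c : 'rV[R]_n) (r : R) : measurable (eball c r).
Proof.
rewrite (_ : eball c r = (fun x => 1 *: x + - c) @^-1`
    (enorm @^-1` `]-oo, r[)); last first.
  by apply/seteqP; split => x; rewrite /eball /= scale1r in_itv.
rewrite -[X in measurable X]setTI; apply: measurable_rV_affine => //.
by rewrite -[X in measurable X]setTI; apply: measurable_enorm.
Qed.

Lemma lebesgue_eball (c : 'rV[R]_n) (r : R) : 0 < r ->
  mu (eball c r) = ((r ^+ n)%:E * mu (eball 0 1))%E.
Proof.
move=> r0; rewrite !lebesgue_rV_borelE; do ?exact: measurable_eball.
rewrite (lebesgue_rV_borel_affine c (lt0r_neq0 r0)); last exact: measurable_eball.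
rewrite gtr0_norm//; congr (_ * lebesgue_rV_borel n _)%E.
apply/seteqP; split => x; rewrite /eball/= addrK subr0 enormZ gtr0_norm//.
  by rewrite gtr_pMr.
by rewrite gtr_pMr.
Qed.

End lebesgue.

Section insertion.
Context {R : realType} {n : nat}.
Variable i : 'I_n.+1.

(** Counterpart of [rV_cons] for an arbitrary coordinate: the measure is built by splitting off the
    first coordinate, whereas the cusps of the proof are thin along the last one. *)
Definition rV_ins (p : measurableTypeR R * 'rV[R]_n) : 'rV[R]_n.+1 :=
  \row_j if unlift i j is Some k then p.2 ord0 k else p.1.

Lemma rV_ins_at p : rV_ins p ord0 i = p.1.
Proof. by rewrite mxE unlift_none. Qed.

Lemma rV_ins_lift p k : rV_ins p ord0 (lift i k) = p.2 ord0 k.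
Proof. by rewrite mxE liftK. Qed.

Lemma measurable_rV_ins : measurable_fun [set: _] rV_ins.
Proof.
apply: measurable_fun_rV => j; case: (unliftP i j) => [k|] ->.
  rewrite (_ : _ \o _ = rV_coor k \o snd); last first.
    by apply/funext => p /=; rewrite /rV_coor rV_ins_lift.
  apply: measurableT_comp; [exact: measurable_rV_coor|exact: measurable_snd].
rewrite (_ : _ \o _ = fst); first exact: measurable_fst.
by apply/funext => p /=; rewrite /rV_coor rV_ins_at.
Qed.

(** On a box the factor of coordinate [i] can be moved to the front of the product, and boxes
    determine the measure; uniqueness of the product measure then gives the order of integration. *)
Lemma lebesgue_rV_borel_ins (A : set 'rV[R]_n.+1) : measurable A ->
  lebesgue_rV_borel n.+1 A =
  (\int[lebesgue_rV_borel n]_z lebesgue_measure (ysection (rV_ins @^-1` A) z))%E.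
Proof.
move=> mA.
have [m mE] := mscale_pushforward_ex
  (@lebesgue_measure R \x lebesgue_rV_borel n)%E ler01 measurable_rV_ins.
rewrite (@lebesgue_rV_borel_unique R n.+1 m)//.
  rewrite mE mul1e.
  have mB : measurable (rV_ins @^-1` A).
    by rewrite -[X in measurable X]setTI; exact: measurable_rV_ins.
  apply: (product_measure_unique
    (m' := (@lebesgue_measure R \x^ lebesgue_rV_borel n)%E) _ mB).
  by move=> B C mB' mC; rewrite /= product_measure2E.
move=> B mB; rewrite mE mul1e (bigD1_ord i)//=.
rewrite -lebesgue_rV_borel_box// -product_measure1E//; last first.
  exact: (measurable_rV_box (A := fun j => B (lift i j))).
congr (_ _); apply/seteqP; split => -[t z] /=.
  by move=> Btz; split => [|k]; [have := Btz i|have := Btz (lift i k)];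
    rewrite ?rV_ins_at ?rV_ins_lift.
move=> [Bt Bz] j; case: (unliftP i j) => [k|] ->; by rewrite ?rV_ins_at ?rV_ins_lift.
Qed.

Definition cube m (r : R) : set 'rV[R]_m :=
  [set x | forall j, `[-r, r]%classic (x ord0 j)].

Lemma measurable_cube m r : measurable (@cube m r).
Proof.
by apply: (measurable_rV_box (A := fun=> `[-r, r]%classic)) => j; exact: measurable_itv.
Qed.

Lemma lebesgue_rV_borel_cube m (r : R) : 0 <= r ->
  lebesgue_rV_borel m (@cube m r) = ((2 * r) ^+ m)%:E.
Proof.
move=> r0; pose I : set (measurableTypeR R) := `[-r, r]%classic.
have mI : measurable I by exact: measurable_itv.
have -> : lebesgue_rV_borel m (@cube m r) = (\prod_(j < m) lebesgue_measure I)%E.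
  exact: (lebesgue_rV_borel_box (A := fun=> I)).
have -> : lebesgue_measure I = (2 * r)%:E.
  rewrite lebesgue_measure_itv/= lte_fin; case: ltP => [_|r0'].
    by rewrite -EFinB; congr EFin; lra.
  by congr EFin; lra.
by rewrite prodEFin prodr_const card_ord.
Qed.

(** A line in direction [i] meets [A] in a set of diameter at most [l], hence inside an interval of
    length [2 * l] centered at any of its points; the projection of [A] lies in a cube of side
    [2 * r]. *)
Lemma lebesgue_slab (A : set 'rV[R]_n.+1) (r l : R) : 0 <= r -> 0 <= l ->
  measurable A -> A `<=` @cube n.+1 r ->
  (forall x y, A x -> A y -> (forall k, x ord0 (lift i k) = y ord0 (lift i k)) ->
     `|x ord0 i - y ord0 i| <= l) ->
  (lebesgue_rV R n.+1 A <= ((2 * r) ^+ n * (2 * l))%:E)%E.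
Proof.
move=> r0 l0 mA Ar Al; rewrite lebesgue_rV_borelE// lebesgue_rV_borel_ins//.
have mB : measurable (rV_ins @^-1` A).
  by rewrite -[X in measurable X]setTI; exact: measurable_rV_ins.
apply: (@le_trans _ _
  (\int[lebesgue_rV_borel n]_z ((2 * l)%:E * (\1_(@cube n r) z)%:E))%E); last first.
  rewrite ge0_integralZl//; last 2 first.
  - by apply/measurable_EFinP; by apply: measurable_indic; exact: measurable_cube.
  - by rewrite lee_fin mulr_ge0.
  rewrite integral_indic//; last exact: measurable_cube.
  have E : lebesgue_rV_borel n (@cube n r) = _ := lebesgue_rV_borel_cube n r0.
  rewrite setIT (_ : _ * (2 * l) = 2 * l * (2 * r) ^+ n); last by ring.
  rewrite [leRHS]EFinM; apply: lee_wpmul2l; first by rewrite lee_fin mulr_ge0.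
  by rewrite le_eqVlt; apply/orP; left; apply/eqP; exact: E.
apply: ge0_le_integral => //.
- exact: measurable_fun_ysection.
- apply/measurable_EFinP; apply: measurable_funM => //.
  by apply: measurable_indic; exact: measurable_cube.
move=> z _; have [->|/set0P[t /=]] := eqVneq (ysection (rV_ins @^-1` A) z) set0.
  by rewrite measure0 mule_ge0// lee_fin mulr_ge0.
rewrite /ysection/= inE => At.
rewrite indicE mem_set ?mule1; last first.
  by move=> k; have := Ar _ At (lift i k); rewrite rV_ins_lift.
pose I : set (measurableTypeR R) := `[t - l, t + l]%classic.
have mI : measurable I by exact: measurable_itv.
apply: (@le_trans _ _ (lebesgue_measure I)).
  apply: le_measure; rewrite ?inE//; first exact: measurable_ysection.
  move=> u /=; rewrite inE => Au; rewrite /I/= in_itv/=.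
  have /(Al _ _ At Au) : forall k,
      rV_ins (t, z) ord0 (lift i k) = rV_ins (u, z) ord0 (lift i k).
    by move=> k; rewrite !rV_ins_lift.
  by rewrite !rV_ins_at/= => /ler_normlP[? ?]; apply/andP; split; lra.
rewrite lebesgue_measure_itv/= lte_fin; case: ifP => _; last by rewrite lee_fin mulr_ge0.
by rewrite -EFinB lee_fin; lra.
Qed.

End insertion.

(** * Integrals of power singularities *)

Section dyadic.
Context {R : realType}.

(** On [S], [f] is dominated by the sum of the functions [a k] times the indicator of [U k], whose
    integrals are bounded by a geometric series. The layers may overlap, so balls can stand in for
    dyadic annuli. *)
Lemma geometric_integral_le d (T : measurableType d) (m : {measure set T -> \bar R})
    (S : set T) (f : T -> R) (a : R^nat) (U : (set T)^nat) (c theta : R) :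
  measurable S -> measurable_fun S f -> (forall x, S x -> 0 <= f x) ->
  (forall k, 0 <= a k) -> (forall k, measurable (U k)) ->
  0 <= c -> 0 <= theta < 1 ->
  (forall x, S x -> exists2 k, U k x & f x <= a k) ->
  (forall k, ((a k)%:E * m (U k) <= (c * theta ^+ k)%:E)%E) ->
  (\int[m]_(x in S) (f x)%:E <= (c / (1 - theta))%:E)%E.
Proof.
move=> mS mf f0 a0 mU c0 /andP[theta0 theta1] fU aU.
have mg k : measurable_fun S (fun x => ((a k)%:E * (\1_(U k) x)%:E)%E).
  apply/measurable_EFinP; apply: measurable_funM => //.
have g0 k x : (0 <= (a k)%:E * (\1_(U k) x)%:E)%E.
  by rewrite -EFinM lee_fin mulr_ge0.
apply: (@le_trans _ _
  (\int[m]_(x in S) (\sum_(0 <= k <oo) ((a k)%:E * (\1_(U k) x)%:E)))%E).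
  apply: ge0_le_integral => //.
  - exact/measurable_EFinP.
  - exact: ge0_emeasurable_sum.
  move=> x Sx; have [k Ux fx] := fU x Sx.
  apply: le_trans (nneseries_lim_ge k.+1 _) => //.
  rewrite big_nat_recr//= indicE mem_set// mule1 (le_trans _ (leeDr _ _))//.
  by apply: sume_ge0.
rewrite integral_nneseries//.
apply: lime_le; first by apply: is_cvg_nneseries => k _ _; exact: integral_ge0.
apply: nearW => N.
apply: (@le_trans _ _ (\sum_(0 <= k < N) (c * theta ^+ k)%:E)%E).
  apply: lee_sum => k _; apply: le_trans (aU k).
  rewrite ge0_integralZl//; last 2 first.
  - by apply/measurable_EFinP; apply: measurable_indic; exact: mU.
  - by rewrite lee_fin.
  apply: lee_wpmul2l; first by rewrite lee_fin.
  rewrite integral_indic//; apply: le_measure; rewrite ?inE//.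
  exact: measurableI.
rewrite sumEFin lee_fin -mulr_sumr ler_wpM2l// -[leRHS]div1r ler_pdivlMr ?subr_gt0//.
have -> : (\sum_(0 <= k < N) theta ^+ k) * (1 - theta) = 1 - theta ^+ N.
  by rewrite big_mkord mulrC -[1 - theta]opprB mulNr -subrX1 opprB.
by rewrite gerBl exprn_ge0.
Qed.

Lemma dyadic_bracket (t : R) : 1 <= t -> exists k, 2 ^+ k <= t < 2 ^+ k.+1.
Proof.
move=> t1.
have ex : exists k, t < 2 ^+ k.
  exists (Num.trunc t).+1; apply: lt_le_trans (truncnS_gt t) _.
  by rewrite -natrX ler_nat ltnW// ltn_expl.
have := ex_minnP ex; case: ex_minnP => -[|k] tk kmin _.
  by move: tk; rewrite expr0 ltNge t1.
exists k; rewrite tk andbT leNgt; apply/negP => /kmin; by rewrite ltnn.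
Qed.

End dyadic.

Section powers.
Context {R : realType}.

Lemma powR_natX (a p : R) k : 0 <= a -> (a ^+ k) `^ p = (a `^ p) ^+ k.
Proof. move=> a0; rewrite -(powR_mulrn k a0) -(powR_mulrn k (powR_ge0 a p)).
by rewrite -!powRrM mulrC. Qed.

Lemma invpow2_bounds (p : R) : 0 < p -> 0 <= (2 `^ p)^-1 < 1.
Proof.
move=> p0; rewrite invr_ge0 powR_ge0/= invf_lt1 ?powR_gt0//.
have := @gt0_ltr_powR R p p0 1 2; rewrite powR1 => -> //; rewrite ?nnegrE ?ltr1n//.
Qed.

(** A dyadic layer where [g] has size r contributes at most a constant times r^(q - p), and these
    bounds form a geometric series. A general [g] serves both the norm on a cusp and the distance to
    the sphere inside a ball. *)
Lemma power_singularity d (T : measurableType d) (m : {measure set T -> \bar R})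
    (S : set T) (g : T -> R) (p q C r0 : R) :
  measurable S -> measurable_fun setT g -> (forall x, S x -> 0 <= g x < r0) ->
  0 < p < q -> 0 <= C ->
  (forall r, 0 < r <= 2 * r0 ->
     (m (S `&` [set x | (g x < r)%R]) <= (C * r `^ q)%:E)%E) ->
  (\int[m]_(x in S) ((g x `^ p)^-1)%:E <=
   (C * 4 `^ q * r0 `^ (q - p) / (1 - (2 `^ (q - p))^-1))%:E)%E.
Proof.
move=> mS mg gS /andP[p0 pq] C0 mC.
have qp : 0 < q - p by rewrite subr_gt0.
have [->|/set0P[x0 Sx0]] := eqVneq S set0.
  rewrite integral_set0 lee_fin divr_ge0// ?mulr_ge0 ?powR_ge0//.
  by rewrite subr_ge0 ltW//; case/andP: (invpow2_bounds qp).
have r0_gt0 : 0 < r0 by have /andP[] := gS _ Sx0; exact: le_lt_trans.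
pose r k := r0 / 2 ^+ k.+1.
have r_gt0 k : 0 < r k by rewrite divr_gt0// exprn_gt0.
(* The bracket yields only the weak bound [g x <= 2 * r k], so the strict sublevel set takes the
   factor 4. Its largest radius, at [k = 0], is [2 * r0], the range allowed in the volume
   hypothesis. *)
apply: (@geometric_integral_le _ _ _ _ _ _ (fun k => (r k `^ p)^-1)
  (fun k => S `&` [set x | g x < 4 * r k])) => //.
- apply: measurable_funTS.
  rewrite (_ : (fun x => _) = (fun x => (g x) `^ (- p))).
    by apply: (@measurableT_comp _ _ _ _ _ _ (@powR R ^~ (- p))) => //;
      exact: measurable_powR.
  by apply/funext => x; rewrite powRN.
- by move=> x _; rewrite invr_ge0 powR_ge0.
- by move=> k; rewrite invr_ge0 powR_ge0.
- move=> k; apply: measurableI => //.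
  rewrite (_ : [set x | g x < 4 * r k] = g @^-1` `]-oo, 4 * r k[); last first.
    by apply/seteqP; split => x /=; rewrite in_itv.
  by rewrite -[X in measurable X]setTI; exact: mg.
- by rewrite !mulr_ge0 ?powR_ge0.
- exact: invpow2_bounds.
- move=> x Sx; have /andP[gx0 gxr] := gS _ Sx.
  move: gx0; rewrite le_eqVlt => /orP[/eqP gx0|gx0].
    exists 0%N; first by split => //=; rewrite -gx0 mulr_gt0.
    by rewrite -gx0 powR0 ?gt_eqF// invr0 invr_ge0 powR_ge0.
  have [|k /andP[kl kr]] := @dyadic_bracket R (r0 / g x).
    by rewrite ler_pdivlMr// mul1r ltW.
  have e0 : 0 < (2 : R) ^+ k by rewrite exprn_gt0.
  exists k.
    split => //=; rewrite /r exprS.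
    move: kl; rewrite ler_pdivlMr// -ler_pdivlMl// mulrC => kl.
    rewrite invfM (_ : 4 * _ = 2 * (r0 / 2 ^+ k)); last by field; rewrite gt_eqF.
    by rewrite (le_lt_trans kl)// ltr_pMl ?divr_gt0// ltr1n.
  rewrite lef_pV2 ?posrE ?powR_gt0//.
  apply: ge0_ler_powR; rewrite ?nnegrE ?(ltW p0) ?(ltW (r_gt0 _)) ?(ltW gx0)//.
  move: kr; rewrite ltr_pdivrMr// => /ltW kr.
  by rewrite /r ler_pdivrMr ?exprn_gt0// mulrC.
move=> k.
apply: (@le_trans _ _ (((r k `^ p)^-1)%:E * (C * (4 * r k) `^ q)%:E)%E).
  apply: lee_wpmul2l; first by rewrite lee_fin invr_ge0 powR_ge0.
  apply: mC; rewrite mulr_gt0//= /r exprS invfM.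
  rewrite (_ : 4 * _ = 2 * (r0 / 2 ^+ k)); last by field; rewrite expf_neq0.
  rewrite ler_pM2l// ler_pdivrMr ?exprn_gt0//; apply: ler_peMr; first exact: ltW.
  by rewrite exprn_ege1// ler1n.
rewrite -EFinM lee_fin powRM ?(ltW (r_gt0 k))//.
have -> : (r k `^ p)^-1 * (C * (4 `^ q * r k `^ q)) = C * 4 `^ q * (r k `^ (q - p)).
  by rewrite powRB ?gt_eqF//; ring.
rewrite -[leRHS]mulrA ler_wpM2l ?mulr_ge0 ?powR_ge0//.
rewrite /r powRM ?invr_ge0 ?exprn_ge0 ?(ltW r0_gt0)// ler_wpM2l ?powR_ge0//.
have /andP[t0 /ltW t1] := invpow2_bounds qp.
rewrite -exprVn powR_natX ?invr_ge0// -[X in X `^ _]powR_inv1// -powRrM mulN1r powRN.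
by rewrite exprS ler_piMl// exprn_ge0.
Qed.

End powers.

(** * The fractional kernel *)

Section measurable_sets.
Context {R : realType} d (T : measurableType d).
Implicit Types f g : T -> R.

Lemma measurable_set_le f g : measurable_fun setT f -> measurable_fun setT g ->
  measurable [set x | f x <= g x].
Proof.
move=> mf mg; rewrite (_ : [set x | _] = (fun x => f x <= g x) @^-1` [set true]) //.
by rewrite -[X in measurable X]setTI; exact: measurable_fun_ler.
Qed.

Lemma measurable_set_lt f g : measurable_fun setT f -> measurable_fun setT g ->
  measurable [set x | f x < g x].
Proof.
move=> mf mg; rewrite (_ : [set x | _] = (fun x => f x < g x) @^-1` [set true]) //.
by rewrite -[X in measurable X]setTI; exact: measurable_fun_ltr.
Qed.

End measurable_sets.

(** Mean value bound for powers; with [a] and [b] the radii of concentric balls it controls the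
    volume of a shell. *)
Lemma ler_subrXX (R : realType) (a b : R) k : 0 <= b -> b <= a ->
  a ^+ k.+1 - b ^+ k.+1 <= k.+1%:R * (a ^+ k * (a - b)).
Proof.
move=> b0 ba; elim: k => [|k IH]; first by rewrite !expr1 expr0; lra.
rewrite (_ : a ^+ k.+2 - _ =
  a * (a ^+ k.+1 - b ^+ k.+1) + b ^+ k.+1 * (a - b)); last first.
  by rewrite !exprS; ring.
have a0 : 0 <= a := le_trans b0 ba.
apply: (@le_trans _ _ (a * (k.+1%:R * (a ^+ k * (a - b))) + a ^+ k.+1 * (a - b))).
  by rewrite lerD ?ler_wpM2l// ler_wpM2r ?subr_ge0// lerXn2r ?nnegrE.
by rewrite -[in leRHS]natr1 !exprS le_eqVlt; apply/orP; left; apply/eqP; ring.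
Qed.

Section kernel.
Context {R : realType} {n : nat}.
Local Notation V := 'rV[R]_n.+1.
Local Notation X := (lebesgue_rV_type R n.+1).
Local Notation mu := (lebesgue_rV R n.+1).
Implicit Types (x y z v c : V) (A S : set V).

Lemma measurable_dot v : measurable_fun [set: V] (dot ^~ v).
Proof.
apply: measurable_sum => i; apply: measurable_funM => //.
exact: measurable_rV_coor.
Qed.

Lemma eball0E (r : R) : eball 0 r = [set x : V | enorm x < r].
Proof. by apply/seteqP; split => x; rewrite /eball/= subr0. Qed.

Lemma eball_sub_cube (r : R) : eball 0 r `<=` @cube R n.+1 r.
Proof.
move=> x; rewrite eball0E /= => xr i; rewrite /cube/= in_itv/= -ler_norml.
exact: le_trans (ler_coor_enorm x i) (ltW xr).
Qed.

Definition unit_ball_volume : R := fine (mu (eball 0 1)).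

Lemma lebesgue_eball_fin c (r : R) : 0 < r ->
  mu (eball c r) = (unit_ball_volume * r ^+ n.+1)%:E.
Proof.
move=> r0; rewrite lebesgue_eball// EFinM muleC fineK//.
rewrite ge0_fin_numE//.
(* Only finiteness matters: the unit ball satisfies the slab bound with [r = 1] and [l = 2]. *)
apply: (@le_lt_trans _ _ ((2 * 1) ^+ n * (2 * 2))%:E); last exact: ltry.
apply: (@lebesgue_slab _ _ ord0) => //; first exact: measurable_eball.
- exact: eball_sub_cube.
- move=> x y /eball_sub_cube/(_ ord0) hx /eball_sub_cube/(_ ord0) hy _.
  move: hx hy; rewrite /= !in_itv/= => /andP[? ?] /andP[? ?].
  by rewrite ler_norml; apply/andP; split; lra.
Qed.

Lemma unit_ball_volume_ge0 : 0 <= unit_ball_volume.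
Proof. by rewrite /unit_ball_volume fine_ge0. Qed.

Lemma lebesgue_shell c (r0 r : R) : 0 < r0 -> 0 < r -> 
  (mu [set x | (r0 - r < enorm (x - c) < r0)%R] <=
   (unit_ball_volume * n.+1%:R * r0 ^+ n * r)%:E)%E.
Proof.
move=> r0_gt0 r_gt0; have w0 := unit_ball_volume_ge0.
have rX0 : 0 <= r0 ^+ n by rewrite exprn_ge0// ltW.
have mS : measurable [set x : V | (r0 - r < enorm (x - c) < r0)%R].
  rewrite (_ : [set x | _] = eball c r0 `&` ~` [set x | enorm (x - c) <= r0 - r]).
    apply: measurableI; first exact: measurable_eball.
    apply: measurableC; apply: measurable_set_le => //.
    rewrite (_ : (fun x => _) = enorm \o (fun x => 1 *: x + - c)); last first.
      by apply/funext => x; rewrite /= scale1r.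
    by apply: measurableT_comp; [exact: measurable_enorm|exact: measurable_rV_affine].
  apply/seteqP; split => x; rewrite /eball/=.
    by move=> /andP[h1 h2]; split => //; apply/negP; rewrite -ltNge.
  by move=> [h1 /negP]; rewrite -ltNge => h2; apply/andP.
(* If [r0 <= r], the volume of the whole ball is already below the bound. *)
have [rr0|rr0] := ltP r r0; last first.
  apply: (@le_trans _ _ (mu (eball c r0))).
    apply: le_measure; rewrite ?inE//.
    - exact: borel_lebesgue_measurable.
    - by apply: borel_lebesgue_measurable; exact: measurable_eball.
    - by move=> x /= /andP[].
  rewrite lebesgue_eball_fin// lee_fin exprSr -!mulrA ler_wpM2l//.
  rewrite mulrCA ler_wpM2l// -[leLHS]mul1r ler_pM ?ler1n// ltW//.
have r1 : 0 < r0 - r by rewrite subr_gt0.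
have mb := @measurable_eball R n.+1 c (r0 - r).
have : (mu [set x : V | (r0 - r < enorm (x - c) < r0)%R] +
        mu (eball c (r0 - r)) <= mu (eball c r0))%E.
  rewrite -measureU//; last 3 first.
  - exact: borel_lebesgue_measurable.
  - exact: borel_lebesgue_measurable.
  - by apply/seteqP; split => x //= [/andP[h1 _]]; rewrite /eball/= ltNge ltW.
  apply: le_measure; rewrite ?inE//.
  - by apply: measurableU; exact: borel_lebesgue_measurable.
  - by apply: borel_lebesgue_measurable; exact: measurable_eball.
  - move=> x /= [/andP[]//|]; rewrite /eball/= => /lt_le_trans; apply.
    by rewrite gerBl ltW.
rewrite !lebesgue_eball_fin// -leeBrDr// => /le_trans; apply.
rewrite -EFinB lee_fin -mulrBr -!mulrA ler_wpM2l//.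
apply: le_trans (ler_subrXX _ _ _) _ => //; [exact: ltW|by rewrite gerBl ltW|].
by rewrite opprB addrCA subrr addr0.
Qed.


Definition kernel (s : R) x : R := (enorm x `^ (n.+1%:R + s))^-1.

Lemma kernel_ge0 s x : 0 <= kernel s x.
Proof. by rewrite invr_ge0 powR_ge0. Qed.

Lemma kernelN s x : kernel s (- x) = kernel s x.
Proof. by rewrite /kernel enormN. Qed.

Lemma measurable_kernel s : measurable_fun [set: V] (kernel s).
Proof.
rewrite (_ : kernel s = (fun t : R => t `^ (- (n.+1%:R + s))) \o enorm).
  by apply: measurableT_comp; [exact: measurable_powR|exact: measurable_enorm].
by apply/funext => x; rewrite /= powRN.
Qed.

(** The complement of the two open balls of radius |v|/2 centered at v/2 and -v/2, which touch at
    0. *)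
Definition cusp v : set V := [set z | `|dot z v| <= dot z z].

Lemma measurable_dotxx : measurable_fun [set: V] (fun x => dot x x).
Proof.
by apply: measurable_sum => i; apply: measurable_funM; exact: measurable_rV_coor.
Qed.

Lemma measurable_cusp v : measurable (cusp v).
Proof.
apply: measurable_set_le; last exact: measurable_dotxx.
by apply: measurableT_comp => //; exact: measurable_dot.
Qed.

Lemma lebesgue_cusp v i (r : R) : 2^-1 <= v ord0 i -> 0 < r ->
  (mu (cusp v `&` eball 0 r) <= (4 * 4 ^+ n.+1 * r ^+ n.+2)%:E)%E.
Proof.
move=> vi r0.
apply: (@le_trans _ _ ((2 * r) ^+ n * (2 * (4 * r ^+ 2)))%:E).
  apply: (@lebesgue_slab _ _ i) => //.
  - exact: ltW.
  - by rewrite mulr_ge0// sqr_ge0.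
  - by apply: measurableI; [exact: measurable_cusp|exact: measurable_eball].
  - by move=> x [_]; exact: eball_sub_cube.
  move=> x y [xv xr] [yv yr] xy; rewrite /cusp/= in xv yv.
  have {}xr : dot x x <= r ^+ 2.
    by move: xr; rewrite eball0E/= => /ltW; rewrite enorm_ler// ltW.
  have {}yr : dot y y <= r ^+ 2.
    by move: yr; rewrite eball0E/= => /ltW; rewrite enorm_ler// ltW.
  have E : dot x v - dot y v = (x ord0 i - y ord0 i) * v ord0 i.
    rewrite /dot !(bigD1_ord i)//= [in X in X - _](eq_bigr
      (fun k => y ord0 (lift i k) * v ord0 (lift i k))).
      by ring.
    by move=> k _; rewrite xy.
  have : `|(x ord0 i - y ord0 i) * v ord0 i| <= 2 * r ^+ 2.
    rewrite -E; move: xv yv; rewrite !ler_norml => /andP[? ?] /andP[? ?].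
    by apply/andP; split; lra.
  rewrite normrM (ger0_norm (le_trans _ vi))// => h.
  have := normr_ge0 (x ord0 i - y ord0 i); nra.
rewrite lee_fin [leLHS](_ : _ = 8 * 2 ^+ n * r ^+ n.+2); last first.
  by rewrite exprMn !exprS; ring.
rewrite ler_wpM2r ?exprn_ge0 ?(ltW r0)// exprS.
have : (2 : R) ^+ n <= 4 ^+ n by rewrite lerXn2r ?nnegrE// ler_nat.
have : 0 <= (4 : R) ^+ n by rewrite exprn_ge0.
by lra.
Qed.

End kernel.

Section kint.
Context {R : realType} {n : nat}.
Local Notation V := 'rV[R]_n.+1.
Local Notation X := (lebesgue_rV_type R n.+1).
Local Notation mu := (lebesgue_rV R n.+1).
Variable s : R.
Hypotheses (s0 : 0 < s) (s1 : s < 1).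
Implicit Types (x y z v c : V) (A S : set V).

Definition kint (A : set V) : \bar R := (\int[mu]_(z in A) (kernel s z)%:E)%E.

Lemma measurable_ekernel (D : set X) : measurable_fun D (fun x : X => (kernel s x)%:E).
Proof.
apply: measurable_funTS; apply/measurable_EFinP.
exact: (measurable_fun_lebesgue (measurable_kernel s)).
Qed.

Lemma ekernel_ge0 x : (0 <= (kernel s x)%:E)%E.
Proof. by rewrite lee_fin kernel_ge0. Qed.

Lemma kint_ge0 A : (0 <= kint A)%E.
Proof. by apply: integral_ge0 => x _; exact: ekernel_ge0. Qed.

Lemma le_kint A B : lebesgue_measurable A -> lebesgue_measurable B ->
  A `<=` B -> (kint A <= kint B)%E.
Proof.
move=> mA mB; rewrite /kint.
exact: (ge0_subset_integral mu mA mB (@measurable_ekernel _) (fun x _ => ekernel_ge0 x)).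
Qed.

Lemma kintU A B : lebesgue_measurable A -> lebesgue_measurable B ->
  A `&` B = set0 -> kint (A `|` B) = (kint A + kint B)%E.
Proof.
move=> mA mB AB; apply: (ge0_integral_setU mu mA mB (@measurable_ekernel _)).
- by move=> x _; exact: ekernel_ge0.
- by rewrite disj_set2E; apply/eqP.
Qed.

Lemma kint_split A B : lebesgue_measurable A -> lebesgue_measurable B ->
  kint A = (kint (A `&` B) + kint (A `&` ~` B))%E.
Proof.
move=> mA mB; rewrite -kintU; first by rewrite -setIUr setUv setIT.
- exact: measurableI.
- by apply: measurableI => //; exact: measurableC.
- by rewrite setIACA setICr setI0.
Qed.

Lemma kintU_le A B : lebesgue_measurable A -> lebesgue_measurable B ->
  (kint (A `|` B) <= kint A + kint B)%E.
Proof.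
move=> mA mB; rewrite (kint_split (measurableU _ _ mA mB) mA) setUK.
apply: leeD => //; apply: le_kint => //; last by move=> x [[]].
by apply: measurableI; [exact: measurableU|exact: measurableC].
Qed.

Lemma kint_opp A : lebesgue_measurable A -> kint [set z | A (- z)] = kint A.
Proof.
move=> mA; rewrite /kint [LHS]integral_mkcond [RHS]integral_mkcond.
rewrite -(@ge0_integral_isometry R n.+1 (-1) 0 _ ((fun z : X => (kernel s z)%:E) \_ A)).
- apply: eq_integral => x _; rewrite /patch addr0 scaleN1r kernelN.
  by congr (if _ then _ else _); apply/idP/idP; rewrite !inE.
- by rewrite normrN1.
- exact: ((measurable_restrictT _ mA).1 (@measurable_ekernel _)).
- by move=> x; rewrite /patch; case: ifP => // _; exact: ekernel_ge0.
Qed.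

(** On 2^k d <= |z| < 2^(k+1) d the kernel is bounded by its value at the inner radius and the
    volume by that of the outer ball. This gives the factor [2 ^+ n.+1]; summing over k gives the
    series of ratio 2^(-s). *)
Definition tail_constant : R := @unit_ball_volume R n * 2 ^+ n.+1 / (1 - (2 `^ s)^-1).

Lemma kint_tail (d : R) : 0 < d ->
  (kint (~` eball 0 d) <= (tail_constant * (d `^ s)^-1)%:E)%E.
Proof.
move=> d0; have w0 := @unit_ball_volume_ge0 R n.
rewrite [leRHS](_ : _ =
  (@unit_ball_volume R n * 2 ^+ n.+1 * (d `^ s)^-1 / (1 - (2 `^ s)^-1))%:E); last first.
  by congr EFin; rewrite /tail_constant; ring.
have r_gt0 k : 0 < 2 ^+ k * d by rewrite mulr_gt0// exprn_gt0.
apply: (@geometric_integral_le _ _ X mu _ _ (fun k => ((2 ^+ k * d) `^ (n.+1%:R + s))^-1)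
  (fun k => eball 0 (2 ^+ k.+1 * d) : set X)) => //.
- by apply: measurableC; apply: borel_lebesgue_measurable; exact: measurable_eball.
- by apply/measurable_EFinP; exact: measurable_ekernel.
- by move=> x _; exact: kernel_ge0.
- by move=> k; rewrite invr_ge0 powR_ge0.
- by move=> k; apply: borel_lebesgue_measurable; exact: measurable_eball.
- by rewrite !mulr_ge0 ?invr_ge0 ?powR_ge0.
- exact: invpow2_bounds.
- move=> x; rewrite eball0E/= => /negP; rewrite -leNgt => dx.
  have [|k /andP[kl kr]] := @dyadic_bracket R (enorm x / d).
    by rewrite ler_pdivlMr// mul1r.
  exists k; first by rewrite eball0E/= -ltr_pdivrMr.
  rewrite lef_pV2 ?posrE ?powR_gt0//; last exact: lt_le_trans dx.
  apply: ge0_ler_powR; rewrite ?nnegrE ?enorm_ge0 ?(ltW (r_gt0 k)) ?addr_ge0 ?(ltW s0)//.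
  by rewrite -ler_pdivlMr.
move=> k; rewrite [X in (_ * X <= _)%E](lebesgue_eball_fin 0 (r_gt0 k.+1)).
rewrite -EFinM lee_fin powRD; last by rewrite (gt_eqF (r_gt0 k)) implybT.
rewrite powR_mulrn ?(ltW (r_gt0 k))// powRM ?exprn_ge0 ?(ltW d0)// powR_natX//.
rewrite le_eqVlt; apply/orP; left; apply/eqP.
set m := n.+1; rewrite exprVn exprS.
rewrite -[2 * 2 ^+ k * d]mulrA.
rewrite [(2 * _) ^+ m]exprMn; field.
by rewrite !expf_neq0 ?gt_eqF ?powR_gt0 ?(r_gt0 k).
Qed.

Lemma kint_tail_fin (d : R) : 0 < d -> kint (~` eball 0 d) \is a fin_num.
Proof.
by move=> d0; rewrite ge0_fin_numE ?kint_ge0// (le_lt_trans (kint_tail d0))// ltry.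
Qed.

(** The constant of [power_singularity] for the kernel exponent p = [n.+1%:R + s], the volume
    exponent q = [n.+1%:R + 1] and the factor of [lebesgue_cusp]; here q - p = 1 - s. *)
Definition cusp_constant : R :=
  4 * 4 ^+ n.+1 * 4 `^ (n.+1%:R + 1) / (1 - (2 `^ (1 - s))^-1).

Lemma kint_cusp v i (r : R) : 2^-1 <= v ord0 i -> 0 < r ->
  (kint (cusp v `&` eball 0 r) <= (cusp_constant * r `^ (1 - s))%:E)%E.
Proof.
move=> vi r0; pose p : R := n.+1%:R + s; pose q : R := n.+1%:R + 1.
have pq : 1 - s = q - p by rewrite /p /q opprD addrACA subrr add0r.
rewrite (_ : cusp_constant * _ =
  4 * 4 ^+ n.+1 * 4 `^ q * r `^ (q - p) / (1 - (2 `^ (q - p))^-1)); last first.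
  by rewrite -pq /cusp_constant; ring.
apply: (@power_singularity R _ X mu (cusp v `&` eball 0 r) (enorm : X -> R)).
- apply: borel_lebesgue_measurable.
  by apply: measurableI; [exact: measurable_cusp|exact: measurable_eball].
- exact: measurable_enormX.
- by move=> x [_]; rewrite eball0E/= enorm_ge0.
- by rewrite ltrD2l s1 andbT addr_gt0.
- by rewrite mulr_ge0 ?exprn_ge0.
move=> t /andP[t0 tr].
apply: (@le_trans _ _ (mu (cusp v `&` eball 0 t))).
  apply: le_measure; rewrite ?inE.
  - apply: borel_lebesgue_measurable; rewrite -setIA -eball0E.
    apply: measurableI; first exact: measurable_cusp.
    by apply: measurableI; exact: measurable_eball.
  - apply: borel_lebesgue_measurable.
    by apply: measurableI; [exact: measurable_cusp|exact: measurable_eball].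
  - by move=> x [[xv _] xt]; split => //; rewrite eball0E.
apply: le_trans (lebesgue_cusp vi t0) _.
by rewrite lee_fin /q natr1 powR_mulrn// ltW.
Qed.

Definition annulus (d r : R) : set V := ~` eball 0 d `&` eball 0 r.

Lemma measurable_annulus (d r : R) : lebesgue_measurable (annulus d r).
Proof.
apply: borel_lebesgue_measurable; apply: measurableI.
  by apply: measurableC; exact: measurable_eball.
exact: measurable_eball.
Qed.

(* If [S] contains a ball touching 0 with inner normal [- v], then outside of
   [S] and of a cusp tangent to the ball lies the reflected ball. *)
Lemma kint_touching S v i (d r : R) : lebesgue_measurable S ->
  2^-1 <= v ord0 i -> 0 < r ->
  [set z | dot z z + dot z v < 0] `<=` S ->
  (kint (~` S `&` annulus d r) <=
   kint (S `&` annulus d r) + (cusp_constant * r `^ (1 - s))%:E)%E.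
Proof.
move=> mS vi r0 BS; set B := [set z | _] in BS.
have mB : lebesgue_measurable B.
  apply: borel_lebesgue_measurable; apply: measurable_set_lt => //.
  by apply: measurable_funD; [exact: measurable_dotxx|exact: measurable_dot].
have mann := measurable_annulus d r.
have mBann : lebesgue_measurable (B `&` annulus d r) by exact: measurableI.
have mC : lebesgue_measurable (cusp v `&` eball 0 r).
  apply: borel_lebesgue_measurable.
  by apply: measurableI; [exact: measurable_cusp|exact: measurable_eball].
have mB' : lebesgue_measurable [set z | (B `&` annulus d r) (- z)].
  have := @measurable_fun_isometry R n.+1 (-1) 0 _ measurableT _ mBann.
  rewrite setTI normrN1 => /(_ erefl).
  rewrite (_ : _ @^-1` _ = [set z | (B `&` annulus d r) (- z)])//.
  by apply/seteqP; split => z /=; rewrite scaleN1r addr0.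
apply: (@le_trans _ _
  (kint ((cusp v `&` eball 0 r) `|` [set z | (B `&` annulus d r) (- z)]))).
  apply: le_kint; [|exact: measurableU|].
    by apply: measurableI => //; exact: measurableC.
  move=> z [/= Sz [zd zr]].
  have : ~ B z by move=> /BS.
  rewrite /B/= => /negP; rewrite -leNgt => zv.
  have [h|h] := leP (dot z v) (dot z z); [left|right].
    by split => //; rewrite /cusp/= ler_norml h andbT; lra.
  split; first by rewrite /B/= !dotNl dotNr; lra.
  by move: zd zr; rewrite /annulus !eball0E/= enormN.
apply: le_trans (kintU_le _ _) _ => //.
rewrite addeC; apply: leeD; last exact: kint_cusp vi r0.
(* The kernel is even, so the reflected part weighs as much as [B] in the annulus, which lies in
   [S]. *)
rewrite kint_opp//; apply: le_kint => //; first exact: measurableI.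
by move=> z [/BS ? ?].
Qed.

End kint.

(** * Double integrals *)

Section pint.
Context {R : realType} {n : nat}.
Local Notation V := 'rV[R]_n.+1.
Local Notation X := (lebesgue_rV_type R n.+1).
Local Notation mu := (lebesgue_rV R n.+1).
Variable s : R.
Implicit Types (x y z v c : V) (A B S : set V) (W : set (X * X)).

(** The codomain carries the Borel sets: they are generated by the coordinates, so a coordinatewise
    check suffices, and [kernel] is Borel. *)
Lemma measurable_diff : measurable_fun [set: X * X] (fun p : X * X => (p.2 : V) - p.1).
Proof.
apply: measurable_fun_rV => i.
rewrite (_ : _ \o _ =
  fun p : X * X => rV_coor i (p.2 : V) - rV_coor i (p.1 : V)); last first.
  by apply/funext => p; rewrite /rV_coor/= !mxE.
have mi : measurable_fun [set: X] (rV_coor i : X -> R).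
  exact: (measurable_fun_lebesgue (measurable_rV_coor i)).
by apply: measurable_funB; apply: measurableT_comp.
Qed.

Definition pkernel (p : X * X) : R := kernel s ((p.2 : V) - p.1).

Lemma measurable_pkernel (D : set (X * X)) : measurable_fun D (fun p => (pkernel p)%:E).
Proof.
apply: measurable_funTS; apply/measurable_EFinP.
apply: (@measurableT_comp _ _ _ _ _ _ (@kernel R n s)); first exact: measurable_kernel.
exact: measurable_diff.
Qed.

Definition pint W : \bar R := (\int[mu \x mu]_(p in W) (pkernel p)%:E)%E.

Lemma le_pint W1 W2 : measurable W1 -> measurable W2 -> W1 `<=` W2 ->
  (pint W1 <= pint W2)%E.
Proof.
move=> m1 m2; rewrite /pint.
apply: (ge0_subset_integral (mu \x mu)%E m1 m2 (@measurable_pkernel _)) => p _.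
by rewrite lee_fin kernel_ge0.
Qed.

Lemma pintU W1 W2 : measurable W1 -> measurable W2 -> W1 `&` W2 = set0 ->
  pint (W1 `|` W2) = (pint W1 + pint W2)%E.
Proof.
move=> m1 m2 W12; apply: (ge0_integral_setU (mu \x mu)%E m1 m2 (@measurable_pkernel _)).
- by move=> p _; rewrite lee_fin kernel_ge0.
- by rewrite disj_set2E; apply/eqP.
Qed.

Let f W := (fun p => (pkernel p)%:E) \_ W.

Let f_ge0 W p : (0 <= f W p)%E.
Proof. by rewrite /f /patch; case: ifP => // _; rewrite lee_fin kernel_ge0. Qed.

Let mf W : measurable W -> measurable_fun setT (f W).
Proof.
by move=> mW; exact: ((measurable_restrictT _ mW).1 (@measurable_pkernel _)).
Qed.

Lemma measurable_translate x A : lebesgue_measurable A ->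
  lebesgue_measurable [set z | A (z + x)].
Proof.
move=> mA; have := @measurable_fun_isometry R n.+1 1 x _ measurableT _ mA.
rewrite setTI normr1 => /(_ erefl).
rewrite (_ : _ @^-1` _ = [set z | A (z + x)])//.
by apply/seteqP; split => z /=; rewrite scale1r.
Qed.

Lemma kint_translate x A : lebesgue_measurable A ->
  kint s [set z | A (z + x)] =
  (\int[mu]_y ((fun y : V => (kernel s (y - x))%:E) \_ A) y)%E.
Proof.
move=> mA; rewrite /kint [LHS]integral_mkcond.
rewrite -(@ge0_integral_isometry R n.+1 1 (- x) _
  ((fun z : X => (kernel s z)%:E) \_ [set z : V | A (z + x)%R])).
- apply: eq_integral => y _; rewrite /patch scale1r.
  by congr (if _ then _ else _); apply/idP/idP; rewrite !inE/= subrK.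
- by rewrite normr1.
- exact: ((measurable_restrictT _ (measurable_translate x mA)).1
    (@measurable_ekernel R n s _)).
- by move=> y; rewrite /patch; case: ifP => // _; exact: ekernel_ge0.
Qed.

Lemma lebesgue_measurable_xsection W (x : X) : measurable W ->
  lebesgue_measurable [set y | W (x, y)].
Proof.
move=> mW; have := measurable_xsection x mW; rewrite /xsection.
by rewrite (_ : [set y | _ \in W] = [set y | W (x, y)])//;
  apply/seteqP; split => y /=; rewrite inE.
Qed.

Let fubini_FE W (x : X) : measurable W ->
  (\int[mu]_y f W (x, y) = kint s [set z : V | W (x, (z + x)%R)])%E.
Proof.
move=> mW; rewrite (kint_translate x (lebesgue_measurable_xsection x mW)).
apply: eq_integral => y _; rewrite /f /patch.
by congr (if _ then _ else _); apply/idP/idP; rewrite !inE.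
Qed.

(** Tonelli, with each section recentered at its base point, so that estimates of [kint] around the
    origin apply at every [x]. *)
Lemma pintE W : measurable W ->
  pint W = (\int[mu]_x kint s [set z : V | W (x, (z + x)%R)])%E.
Proof.
move=> mW; rewrite /pint integral_mkcond.
apply: etrans (@fubini_tonelli1 _ _ _ _ R mu mu _ (mf mW) (@f_ge0 W)) _.
by apply: eq_integral => x _; exact: fubini_FE.
Qed.

Lemma measurable_kint_section W : measurable W ->
  measurable_fun [set: X] (fun x => kint s [set z : V | W (x, (z + x)%R)]).
Proof.
move=> mW; rewrite (_ : (fun x => _) = fubini_F mu (f W)).
  by apply: measurable_fun_fubini_tonelli_F => //; exact: mf.
by apply/funext => x; rewrite /fubini_F fubini_FE.
Qed.

Lemma measurable_swap_set W : measurable W -> measurable [set p : X * X | W (p.2, p.1)].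
Proof.
move=> mW; rewrite -[X in measurable X]setTI.
apply: (_ : measurable_fun setT (fun p : X * X => (p.2, p.1))) => //.
by apply: measurable_fun_pair.
Qed.

Lemma pint_swap W : measurable W -> pint [set p : X * X | W (p.2, p.1)] = pint W.
Proof.
move=> mW; rewrite /pint [LHS]integral_mkcond [RHS]integral_mkcond.
apply: etrans (@fubini_tonelli1 _ _ _ _ R mu mu _
  (mf (measurable_swap_set mW)) (@f_ge0 _)) _.
apply: etrans (esym (@fubini_tonelli2 _ _ _ _ R mu mu _ (mf mW) (@f_ge0 W))).
apply: eq_integral => x _; apply: eq_integral => y _; rewrite /f /patch.
rewrite (_ : pkernel (x, y) = pkernel (y, x)); last by rewrite /pkernel/= -kernelN opprB.
by congr (if _ then _ else _); apply/idP/idP; rewrite !inE.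
Qed.

Lemma nonlocal_LE A B : lebesgue_measurable A -> lebesgue_measurable B ->
  nonlocal_L s A B = pint (A `*` B).
Proof.
move=> mA mB; have mAB : measurable (A `*` B : set (X * X)) by exact: measurableX.
rewrite /pint integral_mkcond.
apply: etrans (esym (@fubini_tonelli2 _ _ _ _ R mu mu _ (mf mAB) (@f_ge0 _))).
apply: eq_integral => y _; apply: eq_integral => x _; rewrite /f /patch.
have -> : ((x, y) \in A `*` B) = (x \in A) && (y \in B).
  by apply/idP/andP; rewrite !inE.
rewrite !indicE; case: (x \in A); case: (y \in B);
  rewrite /= ?(mulr0, mul0r, mulr1) ?mul0r//.
by rewrite mul1r /pkernel/= /kernel enormB.
Qed.

End pint.

(** * Continuity of the exterior contribution *)

Section continuity.
Context {R : realType} {n : nat}.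
Local Notation V := 'rV[R]_n.+1.
Local Notation X := (lebesgue_rV_type R n.+1).
Local Notation mu := (lebesgue_rV R n.+1).
Variable s : R.
Hypotheses (s0 : 0 < s) (s1 : s < 1).
Implicit Types (x y z v c : V) (A B S : set V).

(** Bernoulli gives (1 - t)^k >= 1 - u with u = k t, and (1 + 2u)(1 - u) >= 1 for 0 <= u <= 1/2. *)
Lemma invX_bernoulli (t : R) k : 0 <= t -> 2 * k%:R * t <= 1 -> t < 1 ->
  ((1 - t) ^+ k)^-1 <= 1 + 2 * k%:R * t.
Proof.
move=> t0 kt t1.
have t1' : 0 < 1 - t by rewrite subr_gt0.
have b : 1 - k%:R * t <= (1 - t) ^+ k.
  elim: k {kt} => [|k IH]; first by rewrite mul0r subr0 expr0.
  rewrite exprS -natr1; apply: (@le_trans _ _ ((1 - t) * (1 - k%:R * t))).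
    have : 0 <= k%:R * t * t by rewrite !mulr_ge0.
    by lra.
  by rewrite ler_wpM2l// ltW.
have k0 : 0 <= k%:R * t by rewrite mulr_ge0.
rewrite -[leLHS]div1r ler_pdivrMr ?exprn_gt0//.
apply: (@le_trans _ _ ((1 + 2 * k%:R * t) * (1 - k%:R * t))).
  by move: k0 kt; rewrite -mulrA; set u := k%:R * t => ? ?; nra.
by rewrite ler_wpM2l// addr_ge0// -mulrA mulr_ge0.
Qed.

(** With t = eta / d one has |y - x| >= (1 - t)|y|. Since 0 < 1 - t <= 1 and s < 1, the exponent of
    1 - t may be rounded up to the integer [n.+2], where [invX_bernoulli] applies. *)
Lemma kernel_translate_le x y (eta d : R) : enorm x <= eta -> d <= enorm y ->
  0 < d -> 2 * n.+2%:R * eta <= d ->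
  kernel s (y - x) <= (1 + 2 * n.+2%:R * (eta / d)) * kernel s y.
Proof.
move=> xe dy d0 ed.
have e0 : 0 <= eta := le_trans (enorm_ge0 x) xe.
have n2 : (1 : R) <= n.+2%:R by rewrite ler1n.
set t := eta / d.
have t0 : 0 <= t by rewrite divr_ge0// ltW.
have td : 2 * n.+2%:R * t <= 1 by rewrite /t mulrA ler_pdivrMr// mul1r.
have t1 : t < 1 by nra.
have y0 : 0 < enorm y := lt_le_trans d0 dy.
have t1' : 0 < 1 - t by rewrite subr_gt0.
have yx : (1 - t) * enorm y <= enorm (y - x).
  apply: le_trans (ler_enormB _ _).
  have : eta <= t * enorm y.
    by rewrite /t mulrAC ler_pdivlMr// ler_wpM2l.
  by move=> ?; lra.
have p0 : 0 <= n.+1%:R + s by rewrite addr_ge0// ltW.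
apply: (@le_trans _ _ (((1 - t) * enorm y) `^ (n.+1%:R + s))^-1).
  rewrite /kernel lef_pV2 ?posrE ?powR_gt0 ?mulr_gt0//.
    by apply: ge0_ler_powR => //;
      rewrite nnegrE ?enorm_ge0// mulr_ge0 ?(ltW t1') ?enorm_ge0.
  by apply: lt_le_trans yx; rewrite mulr_gt0.
rewrite powRM ?enorm_ge0 ?(ltW t1')// invfM.
apply: ler_wpM2r; first exact: kernel_ge0.
apply: le_trans (invX_bernoulli t0 td t1).
rewrite lef_pV2 ?posrE ?powR_gt0 ?exprn_gt0//.
rewrite -powR_mulrn ?(ltW t1')//; apply: ger_powR; first by rewrite t1'/= gerBl.
by rewrite -[n.+2]addn1 natrD lerD2l ltW.
Qed.

Lemma kint_annulus_le (r eta : R) : 0 < eta < r ->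
  (kint s (@annulus R n (r - eta) r) <=
   (((r - eta) `^ (n.+1%:R + s))^-1 *
    (@unit_ball_volume R n * n.+1%:R * r ^+ n * (2 * eta)))%:E)%E.
Proof.
move=> /andP[e0 er].
have d0 : 0 < r - eta by rewrite subr_gt0.
apply: (@le_trans _ _
  (\int[mu]_(z in @annulus R n (r - eta) r) (((r - eta) `^ (n.+1%:R + s))^-1)%:E)%E).
  apply: (ge0_le_integral mu (measurable_annulus _ _)).
  - by move=> x _; rewrite lee_fin kernel_ge0.
  - exact: measurable_ekernel.
  - exact: measurable_cst.
  move=> x [xd _]; rewrite lee_fin lef_pV2 ?posrE ?powR_gt0//.
    move: xd; rewrite eball0E/= => /negP; rewrite -leNgt => xd.
    by apply: ge0_ler_powR => //;
      rewrite ?nnegrE ?enorm_ge0 ?(ltW d0) ?addr_ge0 ?(ltW s0).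
  move: xd; rewrite eball0E/= => /negP; rewrite -leNgt; exact: lt_le_trans.
rewrite integral_cst; last exact: measurable_annulus.
rewrite [leRHS]EFinM; apply: lee_wpmul2l; first by rewrite lee_fin invr_ge0 powR_ge0.
(* The annulus contains its inner sphere while the shell is open, hence the doubled width. *)
apply: le_trans (lebesgue_shell 0 (lt_trans e0 er) (_ : 0 < 2 * eta));
  last by rewrite mulr_gt0.
apply: le_measure; rewrite ?inE.
- exact: measurable_annulus.
- have -> : [set x : V | r - 2 * eta < enorm (x - 0) < r] =
      ~` [set x : V | enorm x <= r - 2 * eta] `&` eball 0 r.
    rewrite eball0E; apply/seteqP; split => x /=; rewrite subr0.
      by move=> /andP[h1 h2]; split => //; apply/negP; rewrite -ltNge.
    by move=> [/negP]; rewrite -ltNge => h2 h1; apply/andP.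
  apply: borel_lebesgue_measurable; apply: measurableI; last exact: measurable_eball.
  by apply: measurableC; apply: measurable_set_le => //; exact: measurable_enorm.
- move=> x [xd]; rewrite eball0E/= subr0 => ->; rewrite andbT.
  move: xd; rewrite eball0E/= => /negP; rewrite -leNgt; apply: lt_le_trans.
  by lra.
Qed.

(** After the substitution y = z + x, y stays outside the ball of radius r around x, hence outside
    that of radius r - eta around 0. The bound on [eta] is the smallness condition of
    [kernel_translate_le] at distance r - eta. *)
Lemma kint_translate_le x A (r eta : R) : lebesgue_measurable A ->
  enorm x <= eta -> 0 < eta -> (2 * n.+2%:R + 1) * eta <= r ->
  (kint s ([set z : V | A (z + x)%R] `&` ~` eball 0 r) <=
   (1 + 2 * n.+2%:R * (eta / (r - eta)))%:E * kint s (A `&` ~` eball 0 (r - eta)))%E.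
Proof.
move=> mA xe e0 er.
have n2 : (1 : R) <= n.+2%:R by rewrite ler1n.
have d0 : 0 < r - eta by nra.
set k := (1 + _)%:E.
have k0 : (0 <= k)%E by rewrite lee_fin addr_ge0// mulr_ge0// ltW// divr_gt0.
pose A' := A `&` [set y : V | ~ enorm (y - x) < r].
have mA' : lebesgue_measurable A'.
  apply: measurableI => //; apply: borel_lebesgue_measurable; apply: measurableC.
  by have := @measurable_eball R n.+1 x r.
have mAd : lebesgue_measurable (A `&` ~` eball 0 (r - eta)).
  apply: measurableI => //; apply: borel_lebesgue_measurable; apply: measurableC.
  exact: measurable_eball.
have -> : [set z : V | A (z + x)] `&` ~` eball 0 r = [set z | A' (z + x)].
  by apply/seteqP; split => z; rewrite /A' eball0E/= addrK.
have mK : measurable_fun [set: X] (fun y : X => (kernel s ((y : V) - x))%:E).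
  apply/measurable_EFinP.
  rewrite (_ : (fun y : X => _) = @kernel R n s \o (fun y : X => 1 *: (y : V) - x)).
    apply: measurableT_comp; first exact: measurable_kernel.
    exact: (measurable_fun_lebesgue (measurable_rV_affine 1 (- x))).
  by apply/funext => y /=; rewrite scale1r.
rewrite (kint_translate s x mA') /kint.
rewrite -(ge0_integralZl mu mAd (@measurable_ekernel R n s _)
  (fun y _ => ekernel_ge0 s y) k0).
rewrite [leRHS]integral_mkcond.
apply: (ge0_le_integral mu measurableT).
- by move=> y _; rewrite /patch; case: ifP => // _; rewrite lee_fin kernel_ge0.
- exact: ((measurable_restrictT _ mA').1 (measurable_funTS mK)).
- apply: ((measurable_restrictT _ mAd).1 _).
  by apply: emeasurable_funM; [exact: measurable_cst|exact: measurable_ekernel].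
move=> y _; rewrite /patch; case: ifP; last first.
  by move=> _; case: ifP => // _; rewrite mule_ge0// lee_fin kernel_ge0.
rewrite inE => -[Ay /negP]; rewrite -leNgt => yx.
have dy : r - eta <= enorm y.
  by have := ler_enormD y (- x); rewrite enormN; move=> ?; lra.
rewrite mem_set; last by split => //; rewrite eball0E/=; apply/negP; rewrite -leNgt.
rewrite -EFinM lee_fin; apply: kernel_translate_le => //.
by rewrite lerBrDr; move: er; rewrite mulrDl mul1r.
Qed.

(** Two errors occur, each at most a multiple of [eta]: the kernel changes by a factor close to 1 on
    a mass bounded by that of the whole exterior, and the domain gains a shell of width [eta].
    Neither bound depends on [A]. *)
Lemma kint_translate_continuous (r kappa : R) : 0 < r -> 0 < kappa ->
  exists2 eta, 0 < eta & forall x, enorm x <= eta -> forall A, lebesgue_measurable A ->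
    (kint s ([set z : V | A (z + x)%R] `&` ~` eball 0 r) <=
     kint s (A `&` ~` eball 0 r) + kappa%:E)%E.
Proof.
move=> r0 kappa0.
have mB t : lebesgue_measurable (~` eball 0 t : set V).
  by apply: borel_lebesgue_measurable; apply: measurableC; exact: measurable_eball.
pose P : R := 2 * n.+2%:R.
have P1 : 1 <= P by have : (1 : R) <= n.+2%:R; [rewrite ler1n|rewrite /P; lra].
have P0 : 0 <= P by apply: le_trans P1.
pose J := fine (kint s (~` eball (0 : V) r)).
have JE : kint s (~` eball (0 : V) r) = J%:E by rewrite fineK// kint_tail_fin.
have J0 : 0 <= J by rewrite fine_ge0// kint_ge0.
pose D := ((r / 2) `^ (n.+1%:R + s))^-1 * (@unit_ball_volume R n * n.+1%:R * r ^+ n * 2).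
have D0 : 0 <= D.
  by rewrite !mulr_ge0 ?invr_ge0 ?powR_ge0 ?exprn_ge0 ?unit_ball_volume_ge0 ?(ltW r0).
(* With t <= 2 P eta / r, t <= 1 and a <= J, the product (1 + t)(a + D eta) is at most a + M eta.
   [D] is taken at radius r/2, a lower bound for r - eta. *)
pose M := 2 * P * J / r + 2 * D.
have M0 : 0 <= M.
  apply: addr_ge0; last exact: mulr_ge0.
  by apply: divr_ge0; [apply: mulr_ge0 => //; exact: mulr_ge0|exact: ltW].
(* The first entry gives the condition of [kint_translate_le], the second [M * eta <= kappa]. *)
pose eta := Num.min (r / (P + 1)) (kappa / (M + 1)).
have eta0 : 0 < eta by rewrite lt_min !divr_gt0//; lra.
exists eta => // x xe A mA.
have er : (P + 1) * eta <= r.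
  by rewrite mulrC -ler_pdivlMr; [rewrite ge_min lexx|lra].
have ek : M * eta <= kappa.
  have : eta * (M + 1) <= kappa by rewrite -ler_pdivlMr; [rewrite ge_min lexx orbT|lra].
  nra.
have d2 : r / 2 <= r - eta by nra.
have d0 : 0 < r - eta by nra.
apply: le_trans (kint_translate_le mA xe eta0 er) _.
set t := 2 * _ * _.
have tE : t = P * eta / (r - eta) by rewrite /t -/P mulrA.
have Pe : 0 <= P * eta by rewrite mulr_ge0// ltW.
have t0 : 0 <= t by rewrite tE divr_ge0// ltW.
have t2 : t <= 2 * P * eta / r.
  rewrite tE ler_pdivrMr// [leRHS]mulrAC ler_pdivlMr//.
  clear - Pe d2; nra.
have t1 : t <= 1.
  by rewrite tE ler_pdivrMr// mul1r; lra.
clearbody t.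
pose a := fine (kint s (A `&` ~` eball 0 r)).
have mBr := mB r; have mBd := mB (r - eta).
have aJ : (kint s (A `&` ~` eball 0 r) <= J%:E)%E.
  by rewrite -JE; apply: le_kint => //; exact: measurableI. 
have aE : kint s (A `&` ~` eball 0 r) = a%:E.
  by rewrite fineK// ge0_fin_numE ?kint_ge0// (le_lt_trans aJ)// ltry.
have a0 : 0 <= a by rewrite fine_ge0// kint_ge0.
rewrite aE lee_fin in aJ.
have ad : (kint s (A `&` ~` eball 0 (r - eta)) <= (a + D * eta)%:E)%E.
  rewrite EFinD -aE.
  apply: (@le_trans _ _ (kint s (A `&` ~` eball 0 r `|` @annulus R n (r - eta) r))).
    apply: le_kint; [exact: measurableI| |].
      by apply: measurableU; [exact: measurableI|exact: measurable_annulus].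
    move=> y [Ay yd]; have [yr|yr] := pselect (eball 0 r y); first by right.
    by left.
  apply: le_trans (kintU_le _ _ _) _; [exact: measurableI|exact: measurable_annulus|].
  apply: leeD => //; apply: le_trans (kint_annulus_le _) _.
    by rewrite eta0/=; lra.
  rewrite lee_fin (_ : D * eta = ((r / 2) `^ (n.+1%:R + s))^-1 *
    (@unit_ball_volume R n * n.+1%:R * r ^+ n * (2 * eta))); last first.
    by rewrite /D; ring.
  apply: ler_wpM2r.
    by rewrite !mulr_ge0 ?exprn_ge0 ?unit_ball_volume_ge0 ?(ltW r0) ?(ltW eta0).
  rewrite lef_pV2 ?posrE ?powR_gt0 ?divr_gt0//.
  apply: ge0_ler_powR => //; rewrite ?nnegrE ?(ltW d0) ?divr_ge0 ?(ltW r0)//.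
  by rewrite addr_ge0// ltW.
apply: (@le_trans _ _ ((1 + t)%:E * (a + D * eta)%:E)%E).
  by apply: lee_wpmul2l => //; rewrite lee_fin addr_ge0.
rewrite aE -EFinM -EFinD lee_fin.
have tJ : t * a <= 2 * P * eta / r * J by apply: ler_pM.
have De : 0 <= D * eta by rewrite mulr_ge0// ltW.
have : M * eta = 2 * P * eta / r * J + 2 * (D * eta) by rewrite /M; ring.
nra.
Qed.

End continuity.

(** * Calibration *)

Section ge0_integral.
Context {R : realType} d (T : measurableType d) (m : {measure set T -> \bar R}).
Implicit Types f g h : T -> \bar R.

Lemma le_integralT f g : (forall x, (0 <= f x)%E) ->
  measurable_fun setT f -> measurable_fun setT g -> (forall x, (f x <= g x)%E) ->
  (\int[m]_x f x <= \int[m]_x g x)%E.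
Proof. by move=> f0 mf mg fg; apply: ge0_le_integral. Qed.

Lemma le_integralD f g h :
  (forall x, (0 <= f x)%E) -> (forall x, (0 <= g x)%E) ->
  measurable_fun setT f -> measurable_fun setT g -> measurable_fun setT h ->
  (forall x, (f x + g x <= h x)%E) ->
  (\int[m]_x f x + \int[m]_x g x <= \int[m]_x h x)%E.
Proof.
move=> f0 g0 mf mg mh fgh; rewrite -ge0_integralD//; apply: ge0_le_integral => //.
- by move=> x _; rewrite adde_ge0.
- exact: emeasurable_funD.
Qed.

End ge0_integral.

Section calibration.
Context {R : realType} {n : nat}.
Local Notation V := 'rV[R]_n.+1.
Local Notation X := (lebesgue_rV_type R n.+1).
Local Notation mu := (lebesgue_rV R n.+1).
Variable s : R.
Hypotheses (s0 : 0 < s) (s1 : s < 1).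
Implicit Types (x y z v c : V) (A B E S : set V).

Definition far (d : R) : set (X * X) := [set p | d <= enorm ((p.2 : V) - p.1)].

Lemma measurable_far d : measurable (far d).
Proof.
apply: measurable_set_le => //.
by apply: measurableT_comp; [exact: measurable_enorm|exact: measurable_diff].
Qed.

(** Monotone convergence: two distinct points have positive distance, so the truncations exhaust
    [W]. *)
Lemma pint_far_cvg (W : set (X * X)) : measurable W ->
  (forall p, W p -> (p.1 : V) != p.2) ->
  pint s (W `&` far k.+1%:R^-1) @[k --> \oo] --> pint s W.
Proof.
move=> mW Wneq.
have mF k : measurable (W `&` far k.+1%:R^-1).
  by apply: measurableI => //; exact: measurable_far.
have WE : W = \bigcup_k (W `&` far k.+1%:R^-1).
  apply/seteqP; split => [p Wp|p [k _ []]//].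
  have p0 : 0 < enorm ((p.2 : V) - p.1) by rewrite enorm_gt0 subr_eq0 eq_sym Wneq.
  exists (Num.trunc (enorm ((p.2 : V) - p.1))^-1) => //; split => //=.
  rewrite /far/= invf_ple ?posrE//; apply: ltW; exact: truncnS_gt.
rewrite [X in _ --> X](congr1 (pint s) WE) /pint.
apply: ge0_nondecreasing_set_cvg_integral => //.
- move=> i j ij; apply/subsetPset => p [Wp pi]; split => //.
  by apply: le_trans pi; rewrite lef_pV2 ?posrE// ler_nat.
- by move=> k; exact: measurable_pkernel.
- by move=> k p _; rewrite lee_fin kernel_ge0.
Qed.

Variables (E A : set V) (phi : V -> R).
Hypotheses (mE : lebesgue_measurable E) (mA : lebesgue_measurable A).
Hypotheses (AE : A `&` E = set0) (mphi : measurable_fun [set: X] (phi : X -> R)).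
Hypothesis A_finite : (mu A < +oo)%E.
Hypothesis A_sublevel : forall x y, A x -> phi y < phi x -> (E `|` A) y.

Let mindic : measurable_fun [set: X] (fun x : X => (\1_A x)%:E : \bar R).
Proof. by apply/measurable_EFinP; exact: (@measurable_indic _ X R setT A mA). Qed.

Let mcindic (k : \bar R) : measurable_fun [set: X] (fun x : X => (k * (\1_A x)%:E)%E).
Proof. by apply: emeasurable_funM; [exact: measurable_cst|exact: mindic]. Qed.

Let filled x : set V := E `|` [set y | phi y < phi x].

Let mphi2 : measurable_fun setT (fun p : X * X => phi (p.2 : X)).
Proof. exact: (measurableT_comp mphi measurable_snd). Qed.

Let mphi1 : measurable_fun setT (fun p : X * X => phi (p.1 : X)).
Proof. exact: (measurableT_comp mphi measurable_fst). Qed.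

Let mEA : lebesgue_measurable (~` (E `|` A)).
Proof. by apply: measurableC; exact: measurableU. Qed.

Lemma measurable_filled x : lebesgue_measurable (filled x).
Proof. by apply: measurableU => //; exact: measurable_set_lt. Qed.

(* Integrate the curvature of [filled x] at [x] over [x] in [A]: the part of
   [filled x] inside [A] contributes an antisymmetric kernel and cancels. *)
Lemma calibration (d c : R) : 0 < d -> 0 <= c ->
  (forall x, A x ->
    (kint s ([set z : V | (~` filled x) (z + x)%R] `&` ~` eball 0 d) + c%:E <=
     kint s ([set z : V | filled x (z + x)%R] `&` ~` eball 0 d))%E) ->
  (pint s ((A `*` ~` (E `|` A)) `&` far d) + c%:E * mu A <=
   pint s ((A `*` E) `&` far d))%E.
Proof.
move=> d0 c0 H.
have mfar := measurable_far d.
have mAX B : lebesgue_measurable B -> measurable (A `*` B : set (X * X)).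
  by move=> mB; exact: measurableX.
pose Q : set (X * X) := ((A `*` A) `&` [set p : X * X | phi p.2 < phi p.1]) `&` far d.
pose Q' : set (X * X) := ((A `*` A) `&` [set p : X * X | phi p.1 < phi p.2]) `&` far d.
have mQ : measurable Q.
  by do 2 apply: measurableI => //; [exact: mAX|exact: (measurable_set_lt mphi2 mphi1)].
have mQ' : measurable Q'.
  by do 2 apply: measurableI => //; [exact: mAX|exact: (measurable_set_lt mphi1 mphi2)].
have mP : measurable ((A `*` E) `&` far d : set (X * X)).
  by apply: measurableI => //; exact: mAX.
have mN : measurable ((A `*` ~` (E `|` A)) `&` far d : set (X * X)).
  by apply: measurableI => //; exact: mAX.
have QE : pint s Q' = pint s Q.
  rewrite -(pint_swap s mQ); congr (pint s _); apply/seteqP; split => -[x y];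
    by rewrite /Q /Q' /far /= enormB; tauto.
(* The truncation is made for this: the mass of [Q] is at most |A| times the kernel integral outside
   B_d, so it can be cancelled from both sides. *)
have Qfin : pint s Q \is a fin_num.
  have mB : lebesgue_measurable (~` eball 0 d : set V).
    by apply: borel_lebesgue_measurable; apply: measurableC; exact: measurable_eball.
  rewrite ge0_fin_numE; last by apply: integral_ge0 => p _; rewrite lee_fin kernel_ge0.
  rewrite pintE//.
  apply: (@le_lt_trans _ _ (\int[mu]_x (kint s (~` eball (0 : V) d) * (\1_A x)%:E))%E).
    apply: le_integralT.
    - by move=> x; exact: kint_ge0.
    - exact: measurable_kint_section.
    - exact: mcindic.
    move=> x; rewrite indicE; case: (boolP (x \in A)) => xA; last first.
      rewrite (_ : [set z | _] = set0) ?/kint ?integral_set0 ?mule0//.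
      by apply/seteqP; split => z //; rewrite /Q/= => -[[[/mem_set]]];
        rewrite (negbTE xA).
    rewrite mule1; apply: le_kint => //.
      exact: (measurable_translate x (lebesgue_measurable_xsection x mQ)).
    by move=> z [_]; rewrite /far/= addrK eball0E/= => ?; apply/negP; rewrite -leNgt.
  rewrite ge0_integralZl//; last exact: kint_ge0.
  by rewrite integral_indic// setIT lte_mul_pinfty// ?kint_ge0// kint_tail_fin.
have WP : ((A `*` E) `&` far d) `|` Q =
    [set p : X * X | A p.1 /\ filled p.1 p.2] `&` far d.
  apply/seteqP; split => -[x y] /=.
    by move=> [[[Ax Ey] pd]|[[[Ax Ay] xy] pd]];
      (split; last by []); (split; first by []); [left|right].
  move=> [[Ax [Ey|xy]] pd]; first by left.
  have [Ey|Ay] := A_sublevel Ax xy; first by left.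
  by right.
(* Inclusion only: pairs in [A] at equal height [phi] also lie outside the filled set. They are
   dropped, which goes in the required direction. *)
have WN : ((A `*` ~` (E `|` A)) `&` far d) `|` Q' `<=`
    [set p : X * X | A p.1 /\ ~ filled p.1 p.2] `&` far d.
  move=> [x y] /= [[[Ax nEAy] pd]|[[[Ax Ay] xy] pd]];
    (split; last by []); (split; first by []) => -[Ey|yx].
  - by apply: nEAy; left.
  - exact/nEAy/(A_sublevel Ax).
  - by have : (A `&` E) y by []; rewrite AE.
  - by move: (lt_trans xy yx); rewrite ltxx.
have mWP : measurable ([set p : X * X | A p.1 /\ filled p.1 p.2] `&` far d).
  by rewrite -WP; exact: measurableU.
have mWN : measurable ([set p : X * X | A p.1 /\ ~ filled p.1 p.2] `&` far d).
  have mAT : measurable (A `*` setT : set (X * X)) by apply: mAX; exact: measurableT.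
  have mAE : measurable (A `*` E : set (X * X)) by exact: mAX.
  rewrite (_ : [set p : X * X | A p.1 /\ ~ filled p.1 p.2] =
    (A `*` setT) `&` ~` ((A `*` E) `|`
      ((A `*` setT) `&` [set p : X * X | phi p.2 < phi p.1]))).
    apply: measurableI => //; apply: measurableI => //; apply: measurableC.
    apply: measurableU => //; apply: measurableI => //.
    exact: (measurable_set_lt mphi2 mphi1).
  by apply/seteqP; split => -[x y] /=; rewrite /filled/=; tauto.
have key : (pint s ([set p : X * X | A p.1 /\ ~ filled p.1 p.2] `&` far d) +
            c%:E * mu A <=
            pint s ([set p : X * X | A p.1 /\ filled p.1 p.2] `&` far d))%E.
  rewrite !pintE//.
  have <- : (\int[mu]_x (c%:E * (\1_A x)%:E) = c%:E * mu A)%E.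
    rewrite ge0_integralZl//.
    by rewrite integral_indic// setIT.
  apply: le_integralD.
  - by move=> x; exact: kint_ge0.
  - by move=> x; rewrite -EFinM lee_fin mulr_ge0.
  - exact: measurable_kint_section.
  - exact: mcindic.
  - exact: measurable_kint_section.
  move=> x; rewrite indicE; case: (boolP (x \in A)) => xA; last first.
    rewrite mule0 adde0 [X in (kint s X <= _)%E](_ : _ = set0) ?/kint.
      rewrite integral_set0 integral_ge0//.
      by move=> z _; exact: ekernel_ge0.
    by apply/seteqP; split => z // -[[/mem_set]]; rewrite (negbTE xA).
  rewrite mule1; have /set_mem Ax := xA; have := H _ Ax.
  have e1 (B : set V) : [set z : V | B (z + x)%R] `&` ~` eball 0 d =
      [set z : V | (A x /\ B (z + x)%R) /\ d <= enorm ((z + x)%R - x)].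
    apply/seteqP; split => z /=; rewrite eball0E/= addrK.
      by move=> [Bz /negP]; rewrite -leNgt.
    by move=> [[_ Bz] dz]; split => //; apply/negP; rewrite -leNgt.
  by rewrite !e1.
have := le_trans (leeD2r (c%:E * mu A)%E (le_pint s (measurableU _ _ mN mQ') mWN WN)) key.
rewrite -WP !pintU//; last 2 first.
- by apply/seteqP; split => -[x y] //= [[[_ Ey] _] [[[_ Ay] _] _]];
    have : (A `&` E) y by []; rewrite AE.
- by apply/seteqP; split => -[x y] //= [[[_ nEA] _] [[[_ Ay] _] _]]; apply: nEA; right.
by rewrite QE addeAC leeD2rE.
Qed.

End calibration.

(** * Finite fractional perimeter of balls *)

Section finite_perimeter.
Context {R : realType} {n : nat}.
Local Notation V := 'rV[R]_n.+1.
Local Notation X := (lebesgue_rV_type R n.+1).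
Local Notation mu := (lebesgue_rV R n.+1).
Variable s : R.
Hypotheses (s0 : 0 < s) (s1 : s < 1).
Implicit Types (x y z v c : V) (A B E S : set V).

Lemma measurable_dist c : measurable_fun [set: V] (fun x => enorm (x - c)).
Proof.
rewrite (_ : (fun x => _) = enorm \o (fun x => 1 *: x + - c)).
  by apply: measurableT_comp; [exact: measurable_enorm|exact: measurable_rV_affine].
by apply/funext => x; rewrite /= scale1r.
Qed.

Let measurable_distX c : measurable_fun [set: X] (fun x : X => enorm ((x : V) - c)).
Proof. exact: (measurable_fun_lebesgue (measurable_dist c)). Qed.

Lemma tail_constant_ge0 : 0 <= @tail_constant R n s.
Proof.
rewrite /tail_constant divr_ge0 ?mulr_ge0 ?unit_ball_volume_ge0//.
by rewrite subr_ge0 ltW//; have /andP[] := invpow2_bounds s0.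
Qed.

(** From x in the ball, the outside lies at distance at least g = r - |x - c|, so [kint_tail] bounds
    the inner integral by a multiple of g^(-s). The set {g < t} in the ball has volume of order t,
    and s < 1. *)
Lemma pint_ball_lty c (r : R) A B : 0 < r ->
  lebesgue_measurable A -> lebesgue_measurable B ->
  A `<=` eball c r -> B `<=` ~` eball c r ->
  (pint s (A `*` B) < +oo)%E.
Proof.
move=> r0 mA mB Ar Br.
have mAB : measurable (A `*` B : set (X * X)) by exact: measurableX.
have mball : lebesgue_measurable (eball c r).
  by apply: borel_lebesgue_measurable; exact: measurable_eball.
have mg : measurable_fun [set: X] (fun x : X => r - enorm ((x : V) - c)).
  by apply: measurable_funB => //; exact: measurable_distX.
have mf : measurable_fun [set: X] (fun x : X => ((r - enorm ((x : V) - c)) `^ s)^-1).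
  rewrite (_ : (fun x : X => _) = (@powR R ^~ (- s)) \o
    (fun x : X => r - enorm ((x : V) - c))).
    by apply: measurableT_comp => //; exact: measurable_powR.
  by apply/funext => x; rewrite /= powRN.
pose f : X -> \bar R := fun x => ((@tail_constant R n s)%:E *
  ((((r - enorm ((x : V) - c)) `^ s)^-1)%:E * (\1_(eball c r) x)%:E))%E.
have mi : measurable_fun [set: X] (fun x : X => (\1_(eball c r) x)%:E : \bar R).
  by apply/measurable_EFinP; exact: (@measurable_indic _ X R setT _ mball).
have mfi : measurable_fun [set: X] (fun x : X =>
    (((r - enorm ((x : V) - c)) `^ s)^-1)%:E * (\1_(eball c r) x)%:E)%E.
  by apply: emeasurable_funM; [exact/measurable_EFinP|exact: mi].
have mff : measurable_fun [set: X] f.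
  by apply: emeasurable_funM; [exact: measurable_cst|exact: mfi].
have f0 x : (0 <= (((r - enorm ((x : V) - c)) `^ s)^-1)%:E * (\1_(eball c r) x)%:E)%E.
  by rewrite -EFinM lee_fin mulr_ge0// invr_ge0 powR_ge0.
rewrite pintE//.
apply: (@le_lt_trans _ _ (\int[mu]_x f x)%E).
  apply: le_integralT.
  - by move=> x; exact: kint_ge0.
  - exact: (measurable_kint_section s mAB).
  - exact: mff.
  move=> x; rewrite /f.
  have [Ax|Ax] := pselect (A x); last first.
    rewrite (_ : [set z | _] = set0) ?/kint ?integral_set0.
      by rewrite mule_ge0// lee_fin tail_constant_ge0.
    by apply/seteqP; split => z // -[].
  have xr : enorm (x - c) < r by exact: Ar.
  rewrite indicE mem_set; last exact: Ar.
  rewrite mule1 -EFinM; apply: le_trans (kint_tail _ _); rewrite ?subr_gt0//.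
  apply: le_kint.
  - exact: (measurable_translate x (lebesgue_measurable_xsection x mAB)).
  - by apply: borel_lebesgue_measurable; apply: measurableC; exact: measurable_eball.
  move=> z [_ /= /Br]; rewrite eball0E /eball/= => /negP; rewrite -leNgt => h.
  apply/negP; rewrite -leNgt.
  by have := ler_enormD z (x - c); rewrite addrA => ?; lra.
rewrite /f ge0_integralZl//; last by rewrite lee_fin tail_constant_ge0.
rewrite lte_mul_pinfty ?lee_fin ?tail_constant_ge0//.
have -> : (\int[mu]_x ((((r - enorm ((x : V) - c)) `^ s)^-1)%:E * (\1_(eball c r) x)%:E) =
  \int[mu]_(x in eball c r) (((r - enorm ((x : V) - c)) `^ s)^-1)%:E)%E.
  rewrite [RHS]integral_mkcond; apply: eq_integral => x _; rewrite /patch indicE.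
  by case: ifP => _; rewrite ?mule1 ?mule0.
pose C := @unit_ball_volume R n * n.+1%:R * r ^+ n.
have C0 : 0 <= C by rewrite !mulr_ge0 ?unit_ball_volume_ge0 ?exprn_ge0// ltW.
apply: (@le_lt_trans _ _
  (C * 4 `^ 1 * (2 * r) `^ (1 - s) / (1 - (2 `^ (1 - s))^-1))%:E); last exact: ltry.
(* Exponents s and 1. The strict upper bound on the distance is [2 * r] because the value [r] is
   attained at the center. *)
apply: (@power_singularity R _ X mu (eball c r)
  (fun x : X => r - enorm ((x : V) - c)) s 1 C (2 * r)) => //.
- move=> x; rewrite /eball/= => xr; rewrite subr_ge0 ltW//=.
  by have := enorm_ge0 (x - c); lra.
- by rewrite s0 s1.
move=> t /andP[t0 _]; rewrite powRr1 ?(ltW t0)//.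
apply: le_trans (lebesgue_shell c r0 t0).
rewrite le_eqVlt; apply/orP; left; apply/eqP; congr (mu _).
apply/seteqP; split => x; rewrite /eball/=.
  by move=> [h1 h2]; apply/andP; split => //; lra.
by move=> /andP[h1 h2]; split => //; lra.
Qed.

End finite_perimeter.

(** * The touching point *)

Section geometry.
Context {R : realType} {n : nat}.
Local Notation V := 'rV[R]_n.+1.
Implicit Types (x y z v c : V) (E : set V).

Local Notation e := (delta_mx ord0 ord_max : V).
Definition half_center : V := - (2^-1 *: e).

Lemma dot_delta x (i : 'I_n.+1) : dot x (delta_mx ord0 i) = x ord0 i.
Proof.
rewrite /dot (bigD1 i)//= big1 ?addr0; first by rewrite mxE !eqxx mulr1.
by move=> j ji; rewrite mxE eqxx/= (negbTE ji) mulr0.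
Qed.

Lemma dot_delta_delta (i : 'I_n.+1) : dot (delta_mx ord0 i : V) (delta_mx ord0 i) = 1.
Proof. by rewrite dot_delta mxE !eqxx. Qed.

Lemma sqr_dist_half x : enorm (x - half_center) ^+ 2 = dot x x + x ord0 ord_max + 4^-1.
Proof.
rewrite sqr_enorm opprK !(dotDl, dotDr, dotZl, dotZr) dot_delta_delta.
rewrite (dotC _ x) !dot_delta; by field.
Qed.

Lemma not_eball_opp_delta x : ~ eball (- e) 1 x -> 0 <= dot x x + 2 * x ord0 ord_max.
Proof.
rewrite /eball/= => /negP; rewrite -leNgt opprK => h.
have : 1 <= enorm (x + e) ^+ 2 by rewrite -(expr1n _ 2) lerXn2r ?nnegrE ?enorm_ge0.
rewrite sqr_enorm !(dotDl, dotDr) dot_delta_delta (dotC _ x) !dot_delta; lra.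
Qed.

Lemma half_le_dist x : ~ eball (- e) 1 x -> 2^-1 <= enorm (x - half_center).
Proof.
move=> /not_eball_opp_delta h.
rewrite -(@ler_pXn2r _ 2) ?nnegrE ?enorm_ge0// sqr_dist_half exprVn.
have := dotxx_ge0 x; lra.
Qed.

(** Outside the unit ball x_n >= -|x|^2 / 2, so the squared distance to [half_center] is at least
    1/4 + |x|^2 / 2. The square of 1/2 + m^2/4 is 1/4 + m^2/4 + m^4/16, hence |x|^2 < m^2/2 + m^4/8
    < m^2. *)
Lemma eball_half_small x (m : R) : 0 < m <= 1 -> ~ eball (- e) 1 x ->
  enorm (x - half_center) < 2^-1 + m ^+ 2 / 4 -> enorm x < m.
Proof.
move=> /andP[m0 m1] /not_eball_opp_delta h xm.
have : enorm (x - half_center) ^+ 2 < (2^-1 + m ^+ 2 / 4) ^+ 2.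
  by rewrite ltrXn2r ?nnegrE ?enorm_ge0// addr_ge0// divr_ge0// sqr_ge0.
rewrite sqr_dist_half => h2; rewrite enorm_ltr ?ltW//.
have : (m ^+ 2) ^+ 2 <= m ^+ 2 by rewrite -exprM ler_wiXn2l ?(ltW m0).
rewrite expr2 in h2; nra.
Qed.

Lemma dist_half_le x : enorm (x - half_center) <= enorm x + 2^-1.
Proof.
apply: le_trans (ler_enormD _ _) _; rewrite opprK enormZ ger0_norm//.
by rewrite (enormE (delta_mx _ _)) dot_delta_delta sqrtr1 mulr1.
Qed.

Definition normal x : V := (enorm (x - half_center))^-1 *: (x - half_center).

(** The last coordinate of x + e/2 is at least 3/8 and its norm at most 5/8. *)
Lemma normal_last x : ~ eball (- e) 1 x -> enorm x <= 8^-1 ->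
  2^-1 <= normal x ord0 ord_max.
Proof.
move=> /half_le_dist h x8.
rewrite !mxE !eqxx mulrC ler_pdivlMr; last lra.
rewrite /= mulr1 [- - 2^-1]opprK.
have := dist_half_le x; have := ler_coor_enorm x ord_max.
by rewrite ler_norml => /andP[? ?] ?; lra.
Qed.

(** With y = x - half_center, the hypothesis reads z.y < -|y||z|^2, so |z + y|^2 - |y|^2 < |z|^2 (1
    - 2|y|) <= 0: a ball of radius 1/2 fits inside a larger one touching it at the same point. *)
Lemma touching_ball x z : 2^-1 <= enorm (x - half_center) ->
  dot z z + dot z (normal x) < 0 ->
  enorm (z + x - half_center) < enorm (x - half_center).
Proof.
rewrite /normal dotZr -addrA; move: (x - half_center) => y y2.
have y0 : 0 < enorm y by lra.
rewrite -(ltr_pM2l y0) mulr0 mulrDr mulrA mulfV ?gt_eqF// mul1r => h.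
rewrite enorm_ltr ?enorm_ge0// !(dotDl, dotDr) (dotC y z) sqr_enorm.
have := dotxx_ge0 z; nra.
Qed.

Lemma nbhs0_eball (A : set V) : nbhs (0 : V) A -> exists2 r : R, 0 < r & eball 0 r `<=` A.
Proof.
move=> /nbhs_ballP[r /= r0 rA]; exists r => // x; rewrite eball0E/= => xr; apply: rA.
split=> // i j; rewrite ord1 -ball_normE/= mxE sub0r normrN.
exact: le_lt_trans (ler_coor_enorm x j) xr.
Qed.

Lemma eball_nbhs0 (r : R) : 0 < r -> nbhs (0 : V) (eball 0 r).
Proof.
(* The topology is that of the sup norm, and the Euclidean norm is at most the sum of [n.+1]
   coordinates. *)
move=> r0; apply/nbhs_ballP; exists (r / n.+1%:R) => /=; first by rewrite divr_gt0.
move=> x [_ xr]; rewrite eball0E/=; apply: le_lt_trans (enorm_le_sum x) _.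
have -> : r = \sum_(i < n.+1) (r / n.+1%:R).
  by rewrite sumr_const card_ord -[RHS]mulr_natr divfK// pnatr_eq0.
apply: ltr_sum; first by apply/hasP; exists ord0; rewrite ?mem_index_enum.
move=> i _; have := xr ord0 i; rewrite -ball_normE/= mxE sub0r normrN; exact.
Qed.

(** If the difference were null, every point of B_{r/2} would be in the measure-theoretic interior
    of [E], hence in [E] by normalization, and 0 would be an interior point. *)
Lemma boundary_positive_measure E (r : R) : lebesgue_measurable E ->
  measure_normalized E -> boundary E 0 -> 0 < r ->
  (0 < lebesgue_rV R n.+1 (eball 0 r `\` E))%E.
Proof.
move=> mE [intE _] [_ nint] r0; rewrite lt0e measure_ge0 andbT; apply/eqP => E0.
apply: nint; rewrite /interior.
apply: filterS (eball_nbhs0 (_ : 0 < r / 2)); last by rewrite divr_gt0.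
move=> x; rewrite eball0E/= => xr; apply: intE; exists (r / 2); first by rewrite divr_gt0.
have mb c (t : R) : lebesgue_measurable (eball c t `\` E).
  apply: measurableD => //; apply: borel_lebesgue_measurable; exact: measurable_eball.
apply/eqP; rewrite eq_le measure_ge0 andbT -E0.
apply: le_measure; rewrite ?inE; try exact: mb.
move=> y [yx Ey]; split => //; rewrite eball0E/=; move: yx; rewrite /eball/= => yx.
by have := ler_enormD (y - x) x; rewrite subrK => ?; lra.
Qed.

End geometry.

(** * Truncated curvature as a real number *)

Section curvature.
Context {R : realType} {n : nat}.
Local Notation V := 'rV[R]_n.+1.
Local Notation X := (lebesgue_rV_type R n.+1).
Local Notation mu := (lebesgue_rV R n.+1).
Local Notation e := (delta_mx ord0 ord_max : V).
Variable s : R.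
Hypotheses (s0 : 0 < s) (s1 : s < 1).
Implicit Types (x y z v c : V) (A B E S : set V).

Lemma measurable_outside (d : R) : lebesgue_measurable (~` eball (0 : V) d).
Proof.
by apply: borel_lebesgue_measurable; apply: measurableC; exact: measurable_eball.
Qed.

Lemma truncated_curvatureE E (d : R) : lebesgue_measurable E ->
  truncated_curvature s E d =
  (kint s (E `&` ~` eball 0 d) - kint s (~` E `&` ~` eball 0 d))%E.
Proof.
move=> mE; rewrite /truncated_curvature integralE /kint.
have Em (x : V) : ((\1_E x - \1_(~` E) x) / enorm x `^ (n.+1%:R + s))%R =
    if x \in E then kernel s x else - kernel s x.
  rewrite !indicE /kernel in_setC; case: (x \in E) => /=; first by rewrite subr0 mul1r.
  by rewrite sub0r mulN1r.
congr (_ - _)%E; rewrite setIC [RHS]integral_mkcondr; apply: eq_integral => x _.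
  rewrite funeposE Em /patch; case: ifP => _.
    by apply/max_idPl; rewrite lee_fin kernel_ge0.
  by apply/max_idPr; rewrite lee_fin oppr_le0 kernel_ge0.
rewrite funenegE Em /patch in_setC; case: ifP => _ /=.
  by apply/max_idPr; rewrite lee_fin oppr_le0 kernel_ge0.
by rewrite opprK; apply/max_idPl; rewrite lee_fin kernel_ge0.
Qed.

Lemma kint_outside_fin A (d : R) : 0 < d -> lebesgue_measurable A ->
  kint s (A `&` ~` eball 0 d) \is a fin_num.
Proof.
move=> d0 mA; rewrite ge0_fin_numE ?kint_ge0//.
have := @kint_tail_fin R n s s0 d d0.
rewrite (ge0_fin_numE (kint_ge0 _ _)); apply: le_lt_trans.
have mo := measurable_outside d.
by apply: le_kint => //; exact: measurableI.
Qed.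

(** For d > 0 and measurable [E] both integrals are finite, so [fine] loses nothing and the
    estimates become linear arithmetic over the reals. *)
Definition curv E (d : R) : R :=
  fine (kint s (E `&` ~` eball 0 d)) - fine (kint s (~` E `&` ~` eball 0 d)).

Lemma truncated_curvature_fin E (d : R) : lebesgue_measurable E -> 0 < d ->
  truncated_curvature s E d = (curv E d)%:E.
Proof.
move=> mE d0; rewrite truncated_curvatureE// EFinB !fineK ?kint_outside_fin//.
exact: measurableC.
Qed.

Lemma outside_split A (d r : R) : d < r ->
  A `&` ~` eball (0 : V) d = (A `&` annulus d r) `|` (A `&` ~` eball 0 r).
Proof.
move=> dr; apply/seteqP; split => x; rewrite /annulus !eball0E/=.
  move=> [Ax xd]; have [xr|xr] := pselect (enorm x < r); [by left|by right].
move=> [[Ax [xd _]]//|[Ax xr]]; split => // xd; apply: xr; exact: lt_trans xd dr.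
Qed.

Lemma kint_outside_split A (d r : R) : d < r -> lebesgue_measurable A ->
  kint s (A `&` ~` eball 0 d) =
  (kint s (A `&` annulus d r) + kint s (A `&` ~` eball 0 r))%E.
Proof.
move=> dr mA; rewrite (outside_split A dr) kintU//.
- by apply: measurableI => //; exact: measurable_annulus.
- by apply: measurableI => //; exact: measurable_outside.
- by apply/seteqP; split => x // [[_ [_ xr]] [_ /(_ xr)]].
Qed.

Lemma kint_annulus_fin A (d r : R) : 0 < d -> lebesgue_measurable A ->
  kint s (A `&` annulus d r) \is a fin_num.
Proof.
move=> d0 mA; rewrite ge0_fin_numE ?kint_ge0//.
have := @kint_tail_fin R n s s0 d d0.
rewrite (ge0_fin_numE (kint_ge0 _ _)); apply: le_lt_trans.
have mo := measurable_outside d; have ma := @measurable_annulus R n d r.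
by apply: le_kint; [exact: measurableI|exact: mo|move=> x [_ []]].
Qed.

(** Passing from r to d adds only the annulus, where by [kint_touching] the complement exceeds [S]
    by at most the mass of the cusp. *)
Lemma curv_touching S v i (d r : R) : lebesgue_measurable S ->
  2^-1 <= v ord0 i -> 0 < d < r ->
  [set z | dot z z + dot z v < 0] `<=` S ->
  curv S r - @cusp_constant R n s * r `^ (1 - s) <= curv S d.
Proof.
move=> mS vi /andP[d0 dr] BS; have r0 := lt_trans d0 dr.
have mS' : lebesgue_measurable (~` S) by exact: measurableC.
rewrite /curv !(kint_outside_split dr)//.
have := kint_touching s0 s1 d mS vi r0 BS.
have f1 := kint_annulus_fin r d0 mS; have f2 := kint_annulus_fin r d0 mS'.
have f3 := kint_outside_fin r0 mS; have f4 := kint_outside_fin r0 mS'.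
rewrite (fineD f1 f3) (fineD f2 f4); move: f1 f2.
move: (fine (kint s (S `&` ~` eball 0 r))) (fine (kint s (~` S `&` ~` eball 0 r))) => p q.
case: (kint s (S `&` annulus d r)) => // a _.
case: (kint s (~` S `&` annulus d r)) => // b _.
by rewrite -EFinD lee_fin /= => ?; lra.
Qed.

(** The total does not depend on [A]; an upper bound for the mass of the complement thus becomes a
    lower bound for that of the set. *)
Lemma outside_total A (r : R) : 0 < r -> lebesgue_measurable A ->
  fine (kint s (A `&` ~` eball 0 r)) + fine (kint s (~` A `&` ~` eball 0 r)) =
  fine (kint s (~` eball (0 : V) r)).
Proof.
move=> r0 mA; have mA' : lebesgue_measurable (~` A) by exact: measurableC.
rewrite -(fineD (kint_outside_fin r0 mA) (kint_outside_fin r0 mA')); congr fine.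
rewrite (kint_split s (measurable_outside r) mA) [in RHS]setIC; congr (_ + kint s _)%E.
by rewrite setIC.
Qed.

End curvature.

(** * The curvature bound from the supersolution property *)

Section supersolution.
Context {R : realType} {n : nat}.
Local Notation V := 'rV[R]_n.+1.
Local Notation X := (lebesgue_rV_type R n.+1).
Local Notation mu := (lebesgue_rV R n.+1).
Local Notation e := (delta_mx ord0 ord_max : V).
Variables (s : R) (Omega E : set V).
Hypotheses (s0 : 0 < s) (s1 : s < 1) (Omega_open : open Omega) (Omega0 : Omega 0).
Hypotheses (mE : lebesgue_measurable E) (E_normalized : measure_normalized E).
Hypothesis E_supersolution : variational_supersolution s Omega E.
Hypothesis E_boundary0 : boundary E 0.
Hypothesis E_ball : eball (- e) 1 `<=` E.

Let c0 : V := half_center.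

Lemma curv_origin_touching (d r : R) : 0 < d < r ->
  curv s E r - @cusp_constant R n s * r `^ (1 - s) <= curv s E d.
Proof.
move=> dr; apply: (@curv_touching R n s s0 s1 E e ord_max) => //.
  by rewrite mxE !eqxx invf_le1// ler1n.
(* If |z|^2 + z_n < 0, then |z + e|^2 = 1 + |z|^2 + 2 z_n < 1 - |z|^2. *)
move=> z /= zv; apply: E_ball; rewrite /eball/= opprK enorm_ltr// expr1n.
rewrite !(dotDl, dotDr) dot_delta_delta (dotC e z).
have := dotxx_ge0 z; lra.
Qed.

Lemma supersolution_curv_le (r : R) : 0 < r ->
  curv s E r <= @cusp_constant R n s * r `^ (1 - s).
Proof.
move=> r0; rewrite leNgt; apply/negP => lt_curv.
set w := @cusp_constant R n s * r `^ (1 - s) in lt_curv.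
pose k1 := curv s E r - w.
have k1_gt0 : 0 < k1 by rewrite subr_gt0.
have mE' : lebesgue_measurable (~` E) by exact: measurableC.
(* Translating by x adds at most k1/4 to the outer mass of the complement and, by [outside_total],
   removes at most as much from that of the set. The curvature loses at most k1/2, leaving the gain
   k1/2. *)
have k4 : 0 < k1 / 4 by rewrite divr_gt0.
have [eta eta0 cont] := @kint_translate_continuous R n s s0 s1 r _ r0 k4.
have [rho rho0 Orho] := nbhs0_eball (open_nbhs_nbhs (conj Omega_open Omega0)).
(* [m] bounds the norm on [A]: [eta] controls the translation, [rho] puts [A] inside [Omega], and
   1/8 is what [normal_last] asks. The choice of [eps] below is the one of [eball_half_small]. *)
pose m := Num.min eta (Num.min rho 8^-1).
have m0 : 0 < m by rewrite !lt_min eta0 rho0/= invr_gt0.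
have [m_eta m_rho m8] : [/\ m <= eta, m <= rho & m <= 8^-1].
  by rewrite /m !ge_min !lexx !orbT.
have m1 : 0 < m <= 1 by rewrite m0/= (le_trans m8)// invf_le1 ?ler1n.
pose eps := m ^+ 2 / 4.
have eps0 : 0 < eps by rewrite divr_gt0// exprn_gt0.
pose phi x := enorm (x - c0).
pose R0 := 2^-1 + eps.
have R00 : 0 < R0 by rewrite addr_gt0.
pose A := eball c0 R0 `\` E.
have mball : lebesgue_measurable (eball c0 R0).
  by apply: borel_lebesgue_measurable; exact: measurable_eball.
have mA : lebesgue_measurable A by exact: measurableD.
have AE : A `&` E = set0 by apply/seteqP; split => x // [[]].
have A_small x : A x -> enorm x < m.
  by move=> [xR Ex]; apply: eball_half_small m1 _ xR => /E_ball.
have Anot x : A x -> ~ eball (- e) 1 x by move=> [_ Ex] /E_ball.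
have muA_lty : (mu A < +oo)%E.
  apply: (@le_lt_trans _ _ (mu (eball c0 R0))); last by rewrite lebesgue_eball_fin// ltry.
  by apply: le_measure; rewrite ?inE// => x [].
have muA_gt0 : (0 < mu A)%E.
  apply: lt_le_trans (boundary_positive_measure mE E_normalized E_boundary0 eps0) _.
  apply: le_measure; rewrite ?inE//.
    apply: measurableD => //; apply: borel_lebesgue_measurable.
    exact: measurable_eball.
  move=> x [xe Ex]; split => //; rewrite /eball/=; apply: le_lt_trans (dist_half_le x) _.
  by move: xe; rewrite eball0E/= /R0 => ?; lra.
have mphi : measurable_fun [set: X] (phi : X -> R).
  exact: (measurable_fun_lebesgue (measurable_dist c0)).
have A_sublevel x y : A x -> phi y < phi x -> (E `|` A) y.
  move=> [xR _] yx; have [Ey|Ey] := pselect (E y); [by left|right].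
  by split => //; exact: lt_trans yx xR.
have key (d : R) : 0 < d < r ->
    (pint s ((A `*` ~` (E `|` A)) `&` far d) + (k1 / 2)%:E * mu A <=
     pint s ((A `*` E) `&` far d))%E.
  move=> /andP[d0 dr].
  apply: (calibration s0 mE mA AE mphi muA_lty A_sublevel d0).
    by rewrite divr_ge0// ltW.
  move=> x Ax; set F : set V := E `|` _.
  have mF : lebesgue_measurable F by exact: measurable_filled.
  pose S := [set z : V | F (z + x)].
  have mS : lebesgue_measurable S by exact: measurable_translate.
  have mS' : lebesgue_measurable (~` S) by exact: measurableC.
  have x8 : enorm x <= 8^-1 by rewrite (le_trans (ltW (A_small _ Ax))).
  have BS : [set z | dot z z + dot z (normal x) < 0] `<=` S.
    move=> z /= zv; right; apply: touching_ball => //; exact: half_le_dist (Anot _ Ax).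
  have := curv_touching s0 s1 mS (normal_last (Anot _ Ax) x8) (_ : 0 < d < r) BS.
  rewrite d0 dr -/w => /(_ isT) h1.
  have h2 : fine (kint s (~` S `&` ~` eball 0 r)) <=
      fine (kint s (~` E `&` ~` eball 0 r)) + k1 / 4.
    have le1 : (kint s (~` S `&` ~` eball 0 r) <=
        kint s ([set z : V | (~` E) (z + x)%R] `&` ~` eball 0 r))%E.
      have mo := @measurable_outside R n r.
      have mEx := measurable_translate x mE'.
      apply: le_kint; [exact: measurableI|exact: measurableI|].
      by move=> z [Sz zr]; split => // Ez; apply: Sz; left.
    have := le_trans le1 (cont x (le_trans (ltW (A_small _ Ax)) m_eta) _ mE').
    have f1 := kint_outside_fin s0 r0 mS'; have f2 := kint_outside_fin s0 r0 mE'.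
    by rewrite -(fineK f1) -(fineK f2) -EFinD lee_fin.
  have t1 := outside_total s0 r0 mS; have t2 := outside_total s0 r0 mE.
  have f1 := kint_outside_fin s0 d0 mS'; have f2 := kint_outside_fin s0 d0 mS.
  change ((kint s (~` S `&` ~` eball 0 d) + (k1 / 2)%:E <=
    kint s (S `&` ~` eball 0 d))%E).
  rewrite -(fineK f1) -(fineK f2) -EFinD lee_fin.
  move: h1; rewrite /curv => h1.
  have : k1 = fine (kint s (E `&` ~` eball 0 r)) -
      fine (kint s (~` E `&` ~` eball 0 r)) - w by [].
  lra.
have mEA : lebesgue_measurable (~` (E `|` A)) by apply: measurableC; exact: measurableU.
(* [A] lies in the ball around [c0], and [E] together with [A] covers that ball, so the sphere
   separates the two factors. *)
have L_lty : (pint s (A `*` ~` (E `|` A)) < +oo)%E.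
  apply: (@pint_ball_lty R n s s0 s1 c0 R0 _ _ R00 mA mEA); first by move=> x [].
  by move=> x nEA xR; apply: nEA; have [Ex|Ex] := pselect (E x); [left|right; split].
have super : (pint s (A `*` E) <= pint s (A `*` ~` (E `|` A)))%E.
  rewrite -!nonlocal_LE//; apply: E_supersolution => // x Ax.
  split; first by case: Ax.
  by apply: Orho; rewrite eball0E/=; exact: lt_le_trans (A_small _ Ax) m_rho.
have mAE : measurable (A `*` E : set (X * X)) by exact: measurableX.
have mAF : measurable (A `*` ~` (E `|` A) : set (X * X)) by exact: measurableX.
have neq p : (A `*` ~` (E `|` A)) p -> (p.1 : V) != p.2.
  by case: p => x y /= [Ax nEA]; apply/eqP => xy; apply: nEA; right; rewrite -xy.
have cvgL := @pint_far_cvg R n s _ mAF neq.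
have L_fin : pint s (A `*` ~` (E `|` A)) \is a fin_num.
  by rewrite ge0_fin_numE//; apply: integral_ge0 => p _; rewrite lee_fin kernel_ge0.
have g_fin : ((k1 / 2)%:E * mu A)%E \is a fin_num.
  by rewrite fin_numM// ge0_fin_numE.
(* Only the left side of [key] passes to the limit, along d = 1/(k + 1) < r; its right side is
   bounded by the full [pint s (A]*[E)] and then by [super]. Finiteness makes the result contradict
   k1 |A| / 2 > 0. *)
have : (pint s (A `*` ~` (E `|` A)) <=
        pint s (A `*` ~` (E `|` A)) - (k1 / 2)%:E * mu A)%E.
  rewrite -[leLHS](cvg_lim _ cvgL)//; apply: lime_le.
    by apply/cvg_ex; eexists; exact: cvgL.
  near=> k; rewrite leeBrDr//; apply: le_trans (key _ _) _.
    rewrite invr_gt0 ltr0n/=; near: k.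
    exact: (near_infty_natSinv_lt (PosNum r0)).
  apply: le_trans super; apply: le_pint => //.
  by apply: measurableI => //; exact: measurable_far.
rewrite leeBrDr// -[leRHS]adde0 leeD2lE//; apply/negP; rewrite -ltNge.
by rewrite mule_gt0// lte_fin divr_gt0.
Unshelve. all: by end_near. Qed.

End supersolution.

(** With l the supremum of T(r) - C r^p, T(d) <= l + C d^p holds for every d > 0. For the lower
    bound choose r with T(r) - C r^p > l - eps; then T(d) > l - eps for all d < r. *)
Lemma almost_nonincreasing_cvg (R : realType) (T : R -> R) (C p : R) :
  0 <= C -> 0 < p ->
  (forall d r, 0 < d < r -> T r - C * r `^ p <= T d) ->
  (forall r, 0 < r -> T r <= C * r `^ p) ->
  exists2 l, T d @[d --> 0^'+] --> l & l <= 0.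
Proof.
move=> C0 p0 Tmono Tle.
pose G := [set T r - C * r `^ p | r in [set r | 0 < r]].
have G1 : G (T 1 - C * 1 `^ p) by exists 1 => //=.
have G_ub : ubound G 0 by move=> _ [r /= r0 <-]; rewrite subr_le0 Tle.
have G_sup : has_sup G by split; [exists (T 1 - C * 1 `^ p)|exists 0].
exists (sup G); last by apply: ge_sup => //; exists (T 1 - C * 1 `^ p).
apply/cvgrPdist_le => eps eps0.
have [_ [r /= r0 <-] rG] := sup_adherent eps0 G_sup.
have cvgC : C * d `^ p @[d --> 0^'+] --> (0 : R).
  by rewrite -[X in _ --> X](mulr0 C); apply: cvgMr; exact: powR_cvg0.
near=> d.
have d0 : 0 < d by near: d; exact: nbhs_right_gt.
have dr : 0 < d < r by rewrite d0/=; near: d; exact: nbhs_right_lt.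
have dC : C * d `^ p <= eps.
  have : `|0 - C * d `^ p| <= eps by near: d; move/cvgrPdist_le : cvgC; exact.
  by rewrite sub0r normrN ger0_norm// mulr_ge0 ?powR_ge0.
have h1 := Tmono _ _ dr.
have h2 : T d - C * d `^ p <= sup G by apply: ub_le_sup; [exists 0|exists d].
by rewrite ler_norml; apply/andP; split; lra.
Unshelve. all: by end_near. Qed.

Theorem theorem5p1 (R : realType) (n : nat) (s : R) (Omega E : set 'rV[R]_n.+1)
  (s_gt0 : 0 < s) (s_lt1 : s < 1)
  (Omega_bounded : bounded_set Omega) (Omega_open : open Omega)
  (Omega0 : Omega 0)
  (E_measurable : lebesgue_measurable E)
  (E_normalized : measure_normalized E)
  (E_supersolution : variational_supersolution s Omega E)
  (E_boundary0 : boundary E 0)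
  (E_ball : eball (- delta_mx ord0 ord_max) 1 `<=` E) :
  exists l : R,
    truncated_curvature s E delta @[delta --> 0^'+] --> l%:E /\ l <= 0.
Proof.
have C0 : 0 <= @cusp_constant R n s.
  rewrite /cusp_constant divr_ge0 ?mulr_ge0 ?powR_ge0 ?exprn_ge0//.
  have s1 : 0 < 1 - s by rewrite subr_gt0.
  by rewrite subr_ge0 ltW//; have /andP[] := invpow2_bounds s1.
have [|l cvgl l0] := @almost_nonincreasing_cvg R (curv s E) _ (1 - s) C0 _
    (fun d r => @curv_origin_touching R n s E s_gt0 s_lt1 E_measurable E_ball d r)
    (fun r => @supersolution_curv_le R n s Omega E s_gt0 s_lt1
      Omega_open Omega0 E_measurable E_normalized E_supersolution E_boundary0
      E_ball r).
  by rewrite subr_gt0.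
exists l; split => //.
(* The two functions are shown equal for d > 0 only, which suffices for a right limit at 0. *)
apply: (@cvg_trans _ ((curv s E d)%:E @[d --> 0^'+])).
  apply: near_eq_cvg; near=> d.
  rewrite truncated_curvature_fin//; near: d; exact: nbhs_right_gt.
by apply: cvg_EFin; [exact: nearW|exact: cvgl].
Unshelve. all: by end_near. Qed.
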